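(* Let $k \in \mathbb{N}$ and let $\mathbb{A}$ be an affine subspace of $\mathbb{Q}^k$. Then $\mathbb{A} \cap A^k \neq \emptyset$ for every normal set $A \subset \mathbb{N}$ if and only if $\mathbb{A}$ contains a set of the form $$\{ n\vec{a} + m\vec{b} + \vec{f} \mid n,m \in \mathbb{N} \},$$ where $\vec{a} = (a_1,\ldots,a_k)^t \in \mathbb{N}^k$, $\vec{b} = (b_1,\ldots,b_k)^t \in \mathbb{N}^k$, $\vec{f} = (f_1,\ldots,f_k)^t \in \mathbb{Z}^k$, and there exists a partition $F_1,\ldots,F_l$ of $\{1,2,\ldots,k\}$ such that for every $r \in \{1,\ldots,l\}$ there exist $c_{1,r}, c_{2,r} \in \mathbb{N}$ such that for every $i \in F_r$ we have $a_i = c_{1,r}$ and $b_i = c_{2,r}$, and for every $j \in \{1,\ldots,k\} \setminus F_r$ we have $$\det \begin{pmatrix} a_j & b_j \\ c_{1,r} & c_{2,r} \end{pmatrix} \neq 0.$$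
   Context: $\mathbb{N}$ denotes the positive integers. An infinite $\{0,1\}$-valued sequence $\lambda$ is normal if every finite binary word $w$ occurs in $\lambda$ with frequency $2^{-|w|}$, where $|w|$ is the length of $w$. A set $S \subset \mathbb{N}$ is normal if its indicator sequence $1_S$ is a normal sequence. An affine subspace of $\mathbb{Q}^k$ is a translate of a $\mathbb{Q}$-linear subspace. *)

(* Defs.v *)
From HB Require Import structures.
From mathcomp Require Import all_boot all_order all_algebra.
From mathcomp Require Import all_classical all_reals all_analysis.

Set Implicit Arguments.
Unset Strict Implicit.
Unset Printing Implicit Defensive.

Import Order.TTheory GRing.Theory Num.Theory.
Import numFieldNormedType.Exports.

Local Open Scope classical_set_scope.
Local Open Scope ring_scope.

(* Sequences are indexed from 0: [lam n] is the term number n + 1. *)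
Definition occurs_at (lam : nat -> bool) (w : seq bool) (n : nat) : bool :=
  mkseq (fun i => lam (n + i)%N) (size w) == w.

Definition normal_sequence (R : realType) (lam : nat -> bool) : Prop :=
  forall w : seq bool,
    (fun N : nat => (count (occurs_at lam w) (iota 0 N))%:R / N%:R : R)
      @ \oo --> ((2%:R : R) ^- size w).

(* The positive integers are encoded in nat, whence the exclusion of 0; the
   first term (index 0) of the indicator sequence is that of the integer 1. *)
Definition normal_set (R : realType) (S : set nat) : Prop :=
  S `<=` [set n | (0 < n)%N] /\ normal_sequence R (fun n => n.+1 \in S).

Definition affine_subspace (k : nat) (X : set 'cV[rat]_k) : Prop :=
  exists (v : 'cV[rat]_k) (V : {vspace 'cV[rat]_k}),
    X = [set v + u | u in [set u | u \in V]].

Definition cartesian_power (k : nat) (A : set nat) : set 'cV[rat]_k :=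
  [set x | forall i, exists2 n, A n & x i 0 = n%:R].
Arguments cartesian_power : clear implicits.

Definition two_param_set (k : nat) (a b f : 'cV[int]_k) : set 'cV[rat]_k :=
  [set x | exists n m : nat, [/\ (0 < n)%N, (0 < m)%N &
     x = map_mx intr (a *+ n + b *+ m + f)]].

Definition mx22 (p q r s : int) : 'M[int]_(1 + 1) :=
  block_mx p%:M q%:M r%:M s%:M.

Definition partition_condition (k : nat) (a b : 'cV[int]_k) : Prop :=
  exists2 P : {set {set 'I_k}}, finset.partition P [set: 'I_k]%SET &
    forall F : {set 'I_k}, F \in P -> exists c1 c2 : int,
      [/\ 0 < c1, 0 < c2,
          forall i, i \in F -> a i 0 = c1 /\ b i 0 = c2 &
          forall j, j \notin F -> \det (mx22 (a j 0) (b j 0) c1 c2) <> 0].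

(* Main.v *)
(** Sufficiency.  Put the entries of [A] hit by [n a + m b + f] in runs of 1s:
    it is enough to find [(n, m)] such that [A] contains a long run at each of
    the pairwise non-proportional forms [c1 n + c2 m].  By induction on the
    forms, there is a finite set [E] of pairs such that, for windows of [A]
    that are typical for each form separately (no independence is used), some
    [s] in [E] hits a run for all forms.  To add a form [c0], translate [E] by
    a set [Y] on which [c0] is injective while all earlier forms [c] collapse,
    [#|c(Y)| <= #|Y| / C].  Most translates give a solution for the earlier
    forms; the set of these solutions depends on few entries of [A], hence
    takes at most [2 ^ (eps #|Y|)] values, whereas by normality a window misses
    all runs at [#|Y| / 2] prescribed places with frequency [delta ^ #|Y|].

    Necessity.  Applying the hypothesis to a normal set and to its tail gives a
    strictly positive integral vector [a] in the direction [V] of the affine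
    subspace.  If two coordinates were proportional on [V] with a ratio other
    than 1, all points of [X] would satisfy [p x_i = q x_j + r] with [p <> q].
    A normal set without solutions of this equation is obtained by joining each
    [y] to [x = (q y + r) / p], choosing random bits at the roots of these
    chains, and alternating along them.  Hence a generic [b] in [V] satisfies
    the condition on determinants. *)

Require Import Defs.
From HB Require Import structures.
From mathcomp Require Import all_boot all_order all_algebra.
From mathcomp Require Import all_classical all_reals all_analysis.
From mathcomp Require Import zify ring lra.

Set Implicit Arguments.
Unset Strict Implicit.
Unset Printing Implicit Defensive.

Import Order.TTheory GRing.Theory Num.Theory.
Import numFieldNormedType.Exports.

Local Open Scope classical_set_scope.
Local Open Scope ring_scope.

(** * Sets of pairs on which one linear form is injective and the others collapse *)

Definition lin (c s : nat * nat) : nat := (c.1 * s.1 + c.2 * s.2)%N.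

Definition separated (c : nat * nat) (M : nat) (Y : seq (nat * nat)) : Prop :=
  uniq Y /\ {in Y &, forall y y', y <> y' ->
    (lin c y + M <= lin c y')%N \/ (lin c y' + M <= lin c y)%N}.

(** Induction on [cs]: take [C] copies of [Y] translated along the kernel direction of the new form
    [c]. All copies have the same image under [c], so its relative size drops by a factor [C]; the
    image of an earlier form grows at most [C] times, as [Y] does. As [c0] is not proportional to
    [c], long translations keep the copies apart for [c0]. *)
Lemma collapsing_set (c0 : nat * nat) (cs : seq (nat * nat)) (C M : nat) :
  (0 < C)%N -> (0 < M)%N -> (0 < c0.1)%N ->
  {in cs, forall c, (c.1 * c0.2 != c.2 * c0.1)%N} ->
  exists Y : seq (nat * nat), [/\ (C <= size Y)%N, separated c0 M Y &
    {in cs, forall c, exists2 Z : seq nat, (size Z * C <= size Y)%N &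
       {in Y, forall y, lin c y \in Z}}].
Proof.
move=> C0 M0 c00; elim: cs => [_|c cs IH ncs].
  exists [seq (k * M, 0)%N | k <- iota 0 C]; split=> //.
  - by rewrite size_map size_iota.
  - split.
      by rewrite map_inj_uniq ?iota_uniq// => i j [] /eqP; rewrite eqn_pmul2r// => /eqP.
    move=> _ _ /mapP[i _ ->] /mapP[j _ ->]; rewrite /lin /= => ij.
    have {}ij : i <> j by move=> e; apply: ij; rewrite e.
    have h u v : (u < v)%N -> (c0.1 * (u * M) + c0.2 * 0 + M <= c0.1 * (v * M) + c0.2 * 0)%N.
      move=> uv; have [t ->] : exists t, v = (u + t.+1)%N by exists (v - u.+1)%N; lia.
      by have : (M <= c0.1 * M)%N by [nia]; rewrite !mulnDl; nia.
    by case: (ltngtP i j) ij => // ij _; [left|right]; exact: h.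
have [|Y [CY [uY sY] zY]] := IH; first by move=> d dcs; apply: ncs; rewrite inE dcs orbT.
have cc0 := ncs c (mem_head _ _).
have [N Nle] : exists N, forall y, y \in Y -> (lin c0 y + M <= N)%N.
  exists (M + \max_(y <- Y) lin c0 y)%N => y yY.
  by rewrite addnC leq_add2l (@leq_bigmax_seq _ Y xpredT (lin c0)).
(* A multiple of the kernel direction (- c.2, c.1) of [lin c], shifted by a
   constant vector so as to stay in nat. *)
pose f k (y : nat * nat) := (y.1 + (C - k) * N * c.2, y.2 + k * N * c.1)%N.
have linf d k y : lin d (f k y) = (lin d y + lin d ((C - k) * N * c.2, k * N * c.1))%N.
  by rewrite /lin /f /=; nia.
have sf k k' y y' : (k < C)%N -> (k' < C)%N -> y \in Y -> y' \in Y ->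
    (k, y) <> (k', y') ->
    (lin c0 (f k y) + M <= lin c0 (f k' y'))%N \/
    (lin c0 (f k' y') + M <= lin c0 (f k y))%N.
  move=> kC k'C yY y'Y; rewrite !linf.
  have [->|kk'] := eqVneq k k'.
    move=> nyy'; have [|h|h] := sY y y' yY y'Y; first by move=> e; apply: nyy'; rewrite e.
      by left; lia.
    by right; lia.
  move=> _; have := Nle _ yY; have := Nle _ y'Y.
  move: (lin c0 y) (lin c0 y') => u u' hu' hu.
  rewrite /lin /=; clear -kk' kC k'C hu hu' cc0.
  move: c c0 cc0 => [p1 p2] [a b] /= pab.
  (* Up to a constant, the shift number [i] has [c0]-value [i * N * (p1 * b - p2 * a)], written
     without subtraction; the values for two shifts thus differ by at least [N]. *)
  have E i : (i < C)%N ->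
    (a * ((C - i) * N * p2) + b * (i * N * p1) + i * (N * (p2 * a)) =
     C * N * (a * p2) + i * (N * (p1 * b)))%N.
    move=> iC; have [t ->] : exists t, C = (i + t)%N by exists (C - i)%N; lia.
    by rewrite addKn; nia.
  have := E k kC; have := E k' k'C.
  set A := (_ + b * _)%N; set B := (_ + b * _)%N; move: A B => A B.
  set U := (p2 * a)%N in pab *; set V := (p1 * b)%N in pab *.
  set W := (C * N * _)%N; move: U V W pab => U V W pab eA eB.
  have h1 (i j s t : nat) : (i < j)%N -> (s < t)%N -> 
     (i * (N * t) + j * (N * s) + N <= i * (N * s) + j * (N * t))%N.
    move=> ij st; have [d ->] : exists d, j = (i + d.+1)%N by exists (j - i.+1)%N; lia.
    have [d' ->] : exists d', t = (s + d'.+1)%N by exists (t - s.+1)%N; lia.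
    by nia.
  case: (ltngtP U V) pab => // UV _; case: (ltngtP k k') kk' => // kk _.
  - by left; have := h1 _ _ _ _ kk UV; lia.
  - by right; have := h1 _ _ _ _ kk UV; lia.
  - by right; have := h1 _ _ _ _ kk UV; lia.
  - by left; have := h1 _ _ _ _ kk UV; lia.
exists [seq f k y | k <- iota 0 C, y <- Y]; split.
- by rewrite size_allpairs size_iota; nia.
- split.
    apply: allpairs_uniq; rewrite ?iota_uniq//.
    move=> [k y] [k' y'] /allpairsP[[? ?] [/= + + [-> ->]]] /allpairsP[[? ?] [/= + + [-> ->]]].
    rewrite !mem_iota !add0n /= => kC yY k'C y'Y ff.
    apply: contrapT => /(sf _ _ _ _ kC k'C yY y'Y).
    by rewrite /= in ff; rewrite ff; case; lia.
  move=> _ _ /allpairsP[[k y] [/= + yY ->]] /allpairsP[[k' y'] [/= + y'Y ->]].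
  rewrite !mem_iota !add0n /= => kC k'C ff; apply: sf => // e.
  by apply: ff; case: e => -> ->.
- move=> d; rewrite inE => /orP[/eqP->|dcs].
    exists [seq (lin c y + C * N * c.1 * c.2)%N | y <- Y].
      by rewrite size_map size_allpairs size_iota mulnC.
    move=> _ /allpairsP[[k y] [/= + yY ->]]; rewrite mem_iota add0n /= => kC.
    apply/mapP; exists y => //; rewrite linf; congr addn; rewrite /lin /=.
    have [t ->] : exists t, C = (k + t)%N by exists (C - k)%N; lia.
    by rewrite addKn; nia.
  have [Z sZ zZ] := zY d dcs.
  exists [seq (z + lin d ((C - k) * N * c.2, k * N * c.1))%N | k <- iota 0 C, z <- Z].
    by rewrite !size_allpairs size_iota; nia.
  move=> _ /allpairsP[[k y] [/= kC yY ->]].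
  by rewrite linf; apply/allpairsP; exists (k, lin d y); split=> //=; apply: zZ.
Qed.

(** * Density of patterns in a normal sequence *)

Fixpoint words (n : nat) : seq (seq bool) :=
  if n is m.+1 then [seq true :: u | u <- words m] ++ [seq false :: u | u <- words m]
  else [:: [::]].

Lemma count_words_cat (q m : nat) (P1 P2 : pred (seq bool)) :
  count (fun u => P1 (take q u) && P2 (drop q u)) (words (q + m)) =
  (count P1 (words q) * count P2 (words m))%N.
Proof.
elim: q P1 => [|q IH] P1 /=.
  under eq_count do rewrite take0 drop0.
  by case: (P1 [::]) => /=; rewrite ?addn0 ?mul1n// count_pred0.
rewrite !count_cat !count_map mulnDl -!IH; congr addn.
Qed.

Lemma size_words n : size (words n) = (2 ^ n)%N.
Proof. by elim: n => //= n IH; rewrite size_cat !size_map IH expnS mul2n addnn. Qed.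

Lemma mem_words (u : seq bool) : u \in words (size u).
Proof.
elim: u => //= b u IH; rewrite mem_cat; apply/orP.
by case: b; [left|right]; apply: map_f.
Qed.

Lemma words_size n u : u \in words n -> size u = n.
Proof.
elim: n u => [|n IH] u /=; first by rewrite inE => /eqP ->.
by rewrite mem_cat => /orP[] /mapP[v /IH <- ->].
Qed.

Lemma uniq_words n : uniq (words n).
Proof.
elim: n => //= n IH; rewrite cat_uniq !map_inj_uniq ?IH; try by move=> ? ? [].
by rewrite andbT /=; apply/hasPn => _ /mapP[u _ ->]; apply/mapP => -[].
Qed.

Lemma count_words_ones q : count (all id) (words q) = 1%N.
Proof.
elim: q => //= q IH; rewrite count_cat !count_map.
rewrite [X in (_ + X)%N](@eq_count _ _ pred0) ?count_pred0 ?addn0//.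
Qed.

(** The [n] blocks of length [q] are chosen independently: a marked block avoids one of the [2 ^ q]
    words, an unmarked block is free. *)
Lemma count_words_no_run (q n : nat) (t : pred nat) :
  count (fun u => all (fun i => t i ==> ~~ all id (take q (drop (q * i) u)))
                      (iota 0 n)) (words (q * n)) =
  ((2 ^ q - 1) ^ count t (iota 0 n) * (2 ^ q) ^ (n - count t (iota 0 n)))%N.
Proof.
elim: n t => [|n IH] t; first by rewrite muln0.
rewrite mulnS /= -[X in iota X]/(1 + 0)%N iotaDl count_map.
rewrite (eq_count (a2 := fun u => (t 0%N ==> ~~ all id (take q u)) &&
   all (fun i => t i.+1 ==> ~~ all id (take q (drop (q * i) (drop q u)))) (iota 0 n))); last first.
  move=> u /=; rewrite muln0 drop0 all_map; congr andb; apply: eq_all => i /=.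
  by rewrite add1n mulnS drop_drop addnC.
rewrite (count_words_cat _ _ (fun v => t 0%N ==> ~~ all id v) (fun u =>
   all (fun i => t i.+1 ==> ~~ all id (take q (drop (q * i) u))) (iota 0 n))) IH.
have -> : count (preim (addn 1) t) (iota 0 n) = count (fun i => t i.+1) (iota 0 n) by [].
have := count_size (fun i => t i.+1) (iota 0 n); rewrite size_iota.
set c := count _ (iota 0 n) => cn.
case: (t 0%N) => /=.
  rewrite add1n subSS expnS -mulnA; congr muln.
  have := count_predC (all id) (words q); rewrite count_words_ones size_words => <-.
  by rewrite add1n subn1.
rewrite add0n count_predT size_words subSn// expnS; nia.
Qed.

(* The upper density of [B] is at most [1 / e], in a form that only involves
   nat; [small 0 B] always holds. *)
Definition small (e : nat) (B : pred nat) : Prop :=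
  exists N0, forall N, (N0 <= N)%N -> (count B (iota 0 N) * e <= N)%N.

Definition window (lam : nat -> bool) (x W : nat) : seq bool :=
  mkseq (fun i => lam (x + i)%N) W.

Lemma count_window_cvg (R : realType) lam W (ws : seq (seq bool)) :
  normal_sequence R lam -> uniq ws -> {in ws, forall w, size w = W} ->
  (fun N : nat => (count (fun x => window lam x W \in ws) (iota 0 N))%:R / N%:R : R)
    @ \oo --> ((size ws)%:R / 2 ^+ W : R).
Proof.
move=> nl; elim: ws => [_ _|w ws IH /= /andP[wws uws] sws].
  rewrite mul0r (_ : (fun _ => _) = fun=> 0); first exact: cvg_cst.
  by apply/funext => N; rewrite (@eq_count _ _ pred0) ?count_pred0 ?mul0r.
have sw : size w = W by apply: sws; rewrite mem_head.
have h1 := nl w; rewrite sw in h1.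
have h2 := IH uws (fun v vws => sws v (@mem_behead _ (w :: ws) _ vws)).
have -> : (size (w :: ws))%:R / 2 ^+ W = 2 ^- W + (size ws)%:R / 2 ^+ W :> R.
  by rewrite /= -natr1 mulrDl mul1r addrC.
apply: cvg_trans (cvgD h1 h2); apply: near_eq_cvg; near=> N.
rewrite fctE -mulrDl -natrD; congr (_%:R / _).
rewrite -count_predUI [X in (_ + X)%N](@eq_count _ _ pred0) ?count_pred0 ?addn0; last first.
  move=> x /=; apply/negP => /andP[/eqP]; rewrite sw -/(window lam x W) => ->.
  by rewrite (negPf wws).
by apply: eq_count => x /=; rewrite inE /occurs_at sw.
Unshelve. all: by end_near. Qed.

Lemma small_window (R : realType) lam W (P : pred (seq bool)) (e : nat) :
  normal_sequence R lam -> (count P (words W) * e < 2 ^ W)%N ->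
  small e (fun x => P (window lam x W)).
Proof.
move=> nl Pe; pose ws := [seq w <- words W | P w].
have uws : uniq ws by rewrite filter_uniq// uniq_words.
have sws : {in ws, forall w, size w = W}.
  by move=> w; rewrite mem_filter => /andP[_ /words_size].
case: e Pe => [_|e Pe]; first by exists 0%N => N _; rewrite muln0.
have lt : (size ws)%:R / 2 ^+ W < e.+1%:R^-1 :> R.
  rewrite size_filter ltr_pdivrMr ?exprn_gt0// mulrC ltr_pdivlMr//.
  by rewrite -natrX -natrM ltr_nat.
have := cvgr_lt _ (count_window_cvg nl uws sws) _ lt.
case=> N0 _ h; exists N0.+1 => N N0N; have /= := h N (ltnW N0N).
have N_gt0 : (0 < N)%N by case: N N0N.
rewrite ltr_pdivrMr ?ltr0n// mulrC ltr_pdivlMr// -natrM ltr_nat => /ltnW.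
rewrite (@eq_count _ (fun x => P (window lam x W)) (fun x => window lam x W \in ws))//.
move=> x; rewrite mem_filter; have := mem_words (window lam x W).
by rewrite size_mkseq => ->; rewrite andbT.
Qed.

Lemma small_sub e (B B' : pred nat) : (forall x, B x -> B' x) -> small e B' -> small e B.
Proof.
move=> BB' [N0 h]; exists N0 => N /h; apply: leq_trans.
by rewrite leq_mul2r sub_count ?orbT.
Qed.

Lemma small_has (I : eqType) (s : seq I) (B : I -> pred nat) e n :
  (0 < n)%N -> (size s <= n)%N -> {in s, forall i, small (n * e) (B i)} ->
  small e (fun x => has (B^~ x) s).
Proof.
move=> n0 sn sB.
suff [N0 h] : exists N0, forall N, (N0 <= N)%N ->
    (count (fun x => has (B^~ x) s) (iota 0 N) * (n * e) <= size s * N)%N.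
  exists N0 => N /h hN; rewrite -(leq_pmul2l n0) mulnCA (leq_trans hN)//.
  by rewrite leq_mul2r sn orbT.
elim: s {sn} sB => [_|i s IH sB].
  by exists 0%N => N _; rewrite (@eq_count _ _ pred0)// count_pred0.
have [N1 h1] := sB i (mem_head _ _).
have [|N2 h2] := IH; first by move=> j js; apply: sB; rewrite inE js orbT.
exists (maxn N1 N2) => N; rewrite geq_max => /andP[/h1 {}h1 /h2 {}h2].
rewrite /= mulSn; apply: leq_trans (leq_add h1 h2); rewrite -mulnDl leq_mul2r.
by rewrite -count_predUI leq_addr orbT.
Qed.

(** Markov's inequality for the number of translates of [x] that fall in [B]. The factor 2 pays for
    the overhang [m] of the shifts, since [N + m <= 2 * N]. *)
Lemma small_average (I : eqType) (Y : seq I) (sh : I -> nat) (B : pred nat) e k :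
  (0 < k)%N -> small (2 * k * e) B ->
  small e (fun x => (size Y < k * count (fun y => B (x + sh y)%N) Y)%N).
Proof.
move=> k0 [N0 h]; have [->|Y0] := eqVneq Y [::].
  by exists 0%N => N _; rewrite (@eq_count _ _ pred0) ?count_pred0// => x /=; rewrite muln0.
have {}Y0 : (0 < size Y)%N by case: Y Y0.
pose m := \max_(y <- Y) sh y; exists (N0 + m)%N => N N0N.
have leY : (count (fun x => (size Y < k * count (fun y => B (x + sh y)%N) Y)%N) (iota 0 N)
    * size Y <= k * (size Y * count B (iota 0 (N + m))))%N.
  rewrite -sum1_count big_distrl /=.
  apply: (@leq_trans (\sum_(x <- iota 0 N) k * count (fun y => B (x + sh y)%N) Y)%N).
    rewrite big_mkcond leq_sum//= => x _; case: ifP => // /ltnW; by rewrite mul1n.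
  rewrite -big_distrr leq_mul2l /=; apply/orP; right.
  under eq_bigr do rewrite -sum1_count big_mkcond.
  rewrite exchange_big /= -sum1_size big_distrl /= big_seq [X in (_ <= X)%N]big_seq.
  apply: leq_sum => y yY; rewrite mul1n -big_mkcond sum1_count.
  rewrite -(count_map (addn^~ (sh y)) B) (eq_map (fun=> addnC _ _)) -iotaDl addn0.
  have ym : (sh y <= m)%N by exact: (@leq_bigmax_seq _ Y xpredT sh).
  have -> : (N + m = sh y + (N + (m - sh y)))%N by lia.
  by rewrite !iotaD !count_cat /= add0n addnCA leq_addr.
have {}h := h (N + m)%N ltac:(lia).
move: leY h; set b := count _ _; set d := count _ _ => leY h.
have {}leY : (b <= k * d)%N by rewrite -(leq_pmul2r Y0) -mulnA (mulnC d).
have : (2 * (b * e) <= N + m)%N.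
  by apply: leq_trans h; rewrite (_ : d * (2 * k * e) = 2 * (k * d * e))%N; nia.
lia.
Qed.

(** With [a = Q - 1], Bernoulli's inequality gives [(1 + 1 / a) ^ Q >= 2]. *)
Lemma double_pred_pow Q : (1 < Q)%N -> (2 * (Q - 1) ^ Q <= Q ^ Q)%N.
Proof.
case: Q => // a; rewrite ltnS subn1 /= => a0.
have h n : (a ^ n * (a + n) <= a.+1 ^ n * a)%N.
  elim: n => [|n IH]; first by rewrite !mul1n addn0.
  rewrite !expnS; apply: (@leq_trans (a.+1 * (a ^ n * (a + n)))%N).
    by move: (a ^ n)%N => t; nia.
  by rewrite -mulnA leq_mul2l IH orbT.
have := h a.+1; rewrite -(leq_pmul2r a0); move: (a.+1 ^ _)%N (a ^ _)%N => u v; nia.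
Qed.

(** Every [Q] factors [1 - 1 / Q] gain one half. In [common_run] the term [2 ^ T] is the price of a
    union bound over all records of [T] bits. *)
Lemma pred_pow_small Q T e s : (1 < Q)%N -> (Q * (T + e.+1) <= s)%N ->
  ((Q - 1) ^ s * (2 ^ T * e) < Q ^ s)%N.
Proof.
move=> Q1 le_s; have [t ->] : exists t, s = (Q * (T + e.+1) + t)%N.
  by exists (s - Q * (T + e.+1))%N; lia.
have : (2 ^ (T + e.+1) * ((Q - 1) ^ Q) ^ (T + e.+1) <= (Q ^ Q) ^ (T + e.+1))%N.
  by rewrite -expnMn leq_exp2r ?double_pred_pow// addnS.
have lee : (e < 2 ^ e.+1)%N by apply: leq_trans (ltn_expl e (ltnSn 1)) _; rewrite leq_exp2l.
have p0 : (0 < (Q - 1) ^ (Q * (T + e.+1)))%N by rewrite expn_gt0; lia.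
have tt : ((Q - 1) ^ t <= Q ^ t)%N by case: t {le_s} => // t; rewrite leq_exp2r//; lia.
have t0 : (0 < (Q - 1) ^ t)%N by rewrite expn_gt0; lia.
have T0 : (0 < 2 ^ T)%N by rewrite expn_gt0.
rewrite [in (2 ^ _)%N]expnD -!expnM !(expnD _ (Q * _)%N).
move: (2 ^ T)%N ((Q - 1) ^ (Q * _))%N (Q ^ (Q * _))%N ((Q - 1) ^ t)%N (Q ^ t)%N (2 ^ e.+1)%N
  lee p0 tt t0 T0 => A B D E F G lee p0 tt t0 T0 le1.
have : (A * B * e * E < A * G * B * E)%N.
  by rewrite ltn_pmul2r// mulnAC ltn_pmul2r// ltn_pmul2l.
have : (A * G * B * E <= D * F)%N by apply: leq_mul.
by rewrite (_ : B * E * (A * e) = A * B * e * E)%N; [lia|nia].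
Qed.

Definition run (lam : nat -> bool) (q x : nat) : bool := all id (window lam x q).

Lemma small_no_run (R : realType) lam q (T : seq nat) e :
  normal_sequence R lam -> uniq T ->
  ((2 ^ q - 1) ^ size T * e < (2 ^ q) ^ size T)%N ->
  small e (fun x => all (fun t => ~~ run lam q (x + q * t)) T).
Proof.
move=> nl uT le_e; pose n := (\max_(t <- T) t).+1.
have Tn t : t \in T -> (t < n)%N by move=> tT; rewrite ltnS (@leq_bigmax_seq _ T xpredT id).
have cT : count (mem T) (iota 0 n) = size T.
  rewrite -size_filter; apply: perm_size; apply: uniq_perm => //.
    by rewrite filter_uniq// iota_uniq.
  move=> t; rewrite mem_filter mem_iota /= add0n.
  by have [/Tn ->|] := boolP (t \in T).
have sTn : (size T <= n)%N by rewrite -cT -[leqRHS](size_iota 0) count_size.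
pose P u := all (fun i => (i \in T) ==> ~~ all id (take q (drop (q * i) u))) (iota 0 n).
apply: (@small_sub _ _ (fun x => P (window lam x (q * n)))); last first.
  apply: (small_window nl); rewrite (count_words_no_run q n (mem T)) cT.
  rewrite mulnAC expnM -{2}(subnKC sTn) expnD ltn_pmul2r// expn_gt0 expn_gt0//.
move=> x /allP nr; apply/allP => i _; apply/implyP => iT.
have := nr i iT; rewrite /run; congr (~~ all id _).
rewrite /window /mkseq -map_drop -map_take drop_iota take_iota add0n.
have -> : minn q (q * n - q * i) = q.
  by apply/minn_idPl; have := Tn i iT; nia.
rewrite -[in RHS](addn0 (q * i)%N) iotaDl -map_comp; apply: eq_map => j /=.
by rewrite addnA.
Qed.

(** * A common run for pairwise non-proportional forms *)

Definition padd (y s : nat * nat) : nat * nat := (y.1 + s.1, y.2 + s.2)%N.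

Lemma lin_padd c y s : lin c (padd y s) = (lin c y + lin c s)%N.
Proof. by rewrite /lin /padd /=; lia. Qed.

Lemma count_has_le (I J : Type) (b : I -> pred J) (s : seq I) (Y : seq J) :
  (count (fun y => has (b^~ y) s) Y <= \sum_(i <- s) count (b i) Y)%N.
Proof.
elim: s => [|i s IH]; first by rewrite big_nil count_pred0.
rewrite big_cons; apply: leq_trans (leq_add (leqnn _) IH).
by rewrite -count_predUI leq_addr.
Qed.

Lemma sub_in_count (T : eqType) (P1 P2 : pred T) (s : seq T) :
  {in s, forall x, P1 x -> P2 x} -> (count P1 s <= count P2 s)%N.
Proof.
move=> sP; rewrite (@eq_in_count _ P1 (predI P1 P2)); last first.
  by move=> x /sP /= P12; case: (P1 x) P12 => // ->.
by apply: sub_count => x /andP[].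
Qed.

Lemma common_run (R : realType) lam q (cs : seq (nat * nat)) :
  normal_sequence R lam -> (0 < q)%N -> uniq cs ->
  {in cs, forall c, (0 < c.1)%N} ->
  {in cs &, forall c c', c <> c' -> (c.1 * c'.2 != c.2 * c'.1)%N} ->
  forall e, exists (E : seq (nat * nat)) (G : nat * nat -> pred nat),
    {in cs, forall c, small e (predC (G c))} /\
    forall x : nat * nat -> nat, {in cs, forall c, G c (x c)} ->
      exists2 s, s \in E & {in cs, forall c, run lam q (x c + q * lin c s)}.
Proof.
move=> nl q0; elim: cs => [_ _ _ e|c0 cs IH /= /andP[c0cs ucs] pos ncs e].
  by exists [:: (0, 0)%N], (fun=> predT); split=> // x _; exists (0, 0)%N; rewrite ?mem_head.
have tailP c : c \in cs -> c \in c0 :: cs by move=> h; rewrite inE h orbT.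
have {IH} := IH ucs (fun c h => pos c (tailP c h))
  (fun c c' h h' => ncs c c' (tailP c h) (tailP c' h')).
(* [small_average] is used with [k = 2 * l]: each earlier form then fails on at most [1 / (2 * l)]
   of the translates, so all of them together fail on at most half. *)
pose l := (size cs).+1; case/(_ (2 * (2 * l) * e)%N) => E [G [smG EG]].
pose Q := (2 ^ q)%N; have Q1 : (1 < Q)%N by rewrite -[1%N](expn0 2) ltn_exp2l.
(* [C] is large enough to make both [4 * Q * size T] and [4 * Q * e.+2] at most [size Y], which
   yields [sTe]. *)
pose m := size E; pose C := (4 * Q * (l * m).+1 * e.+2)%N.
(* With this separation, adding elements of [E] to distinct points of [Y] cannot make their
   [c0]-values collide. *)
pose M := (\max_(s <- E) lin c0 s).+1.
have EM s : s \in E -> (lin c0 s < M)%N by move=> sE; rewrite ltnS (@leq_bigmax_seq _ E xpredT (lin c0)).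
have [|||c ccs|Y [CY [uY sepY] ZY]] := @collapsing_set c0 cs C M.
- by rewrite /C !muln_gt0/=; lia.
- by [].
- by apply: pos; rewrite mem_head.
- apply: ncs (tailP _ ccs) (mem_head _ _) _ => cc0; by move: c0cs; rewrite -cc0 ccs.
(* [T] lists all the values that the earlier forms can take on [Y + E]; the collapse makes it short
   compared with [Y]. *)
have [T [sT TP]] : exists T : seq ((nat * nat) * nat), (size T * C <= size cs * m * size Y)%N /\
    forall c y s, c \in cs -> y \in Y -> s \in E -> (c, lin c (padd y s)) \in T.
  elim: (cs) ZY => [_|c ds IH ZY]; first by exists [::].
  have [|T [sT TP]] := IH; first by move=> d h; apply: ZY; rewrite inE h orbT.
  have [Z sZ ZP] := ZY c (mem_head _ _).
  exists ([seq (c, z + lin c s)%N | z <- Z, s <- E] ++ T); split.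
    by rewrite size_cat size_allpairs /= -/m; nia.
  move=> d y s; rewrite inE mem_cat => /orP[/eqP ->|dds] yY sE; last by rewrite TP ?orbT.
  by rewrite lin_padd; apply/orP; left; apply/allpairsP; exists (lin c y, s); split=> //=; exact: ZP.
have sTe : (2 * Q * (size T + e.+1) <= size Y)%N.
  have h1 : (size T * (4 * Q) * (l * m).+1 <= (l * m) * size Y)%N.
    apply: (@leq_trans (size T * C)%N); last by apply: leq_trans sT _; rewrite /l; nia.
    by rewrite /C !mulnA leq_pmulr.
  have h2 : (size T * (4 * Q) <= size Y)%N.
    by move: h1; move: (l * m)%N (size T * _)%N => u v; nia.
  have h3 : (4 * Q * e.+2 <= size Y)%N.
    by apply: leq_trans CY; rewrite /C -!mulnA; rewrite !leq_pmul2l//; nia.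
  by clear -h2 h3; move: (Q) h2 h3 => Q' h2 h3; nia.
(* [v] records which of the possible runs listed in [T] are present: the
   solutions for the forms in [cs] depend on [v] only. *)
pose sol v y s := all (fun c => (c, lin c (padd y s)) \in mask v T) cs.
pose Yv v := [seq y <- Y | has (sol v y) E].
pose st v y := nth (0, 0)%N E (find (sol v y) E).
pose S v := [seq lin c0 (padd y (st v y)) | y <- Yv v].
(* Bad event for a hypothetical record [v]: it solves the earlier forms on at least half of [Y], yet
   [c0] meets no run at these solutions. Since [S v] is determined by [v] alone, the event is rare
   by normality, and [G0] can exclude it for all [v] at once. *)
pose B v x := (size Y <= 2 * size (Yv v))%N && all (fun t => ~~ run lam q (x + q * t)) (S v).
have stE v y : y \in Yv v -> st v y \in E.
  by rewrite mem_filter has_find => /andP[h _]; rewrite mem_nth.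
have uS v : uniq (S v).
  rewrite map_inj_in_uniq ?filter_uniq// => y y' yY y'Y; rewrite !lin_padd => yy'.
  apply: contrapT; have := EM _ (stE _ _ yY); have := EM _ (stE _ _ y'Y).
  move: yY y'Y; rewrite !mem_filter => /andP[_ yY] /andP[_ y'Y].
  move=> h1 h2 ny; have : (lin c0 y + M <= lin c0 y')%N \/ (lin c0 y' + M <= lin c0 y)%N.
    exact: sepY.
  by lia.
pose G0 x := ~~ has (B^~ x) (words (size T)).
pose G1 c x := (2 * l * count (fun y => ~~ G c (x + q * lin c y)%N) Y <= size Y)%N.
exists [seq padd y s | y <- Y, s <- E], (fun c => if c == c0 then G0 else G1 c); split.
  move=> c; rewrite inE; case: eqP => [_ _|_ /= ccs].
    apply: (@small_sub _ _ (fun x => has (B^~ x) (words (size T)))).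
      by move=> x /=; rewrite negbK.
    apply: (@small_has _ _ _ _ (2 ^ size T)); rewrite ?expn_gt0 ?size_words// => v _.
    have [h|h] := leqP (size Y) (2 * size (Yv v)); last first.
      apply: (@small_sub _ _ pred0) => [x|]; first by rewrite /B leqNgt h.
      by exists 0%N => N _; rewrite count_pred0.
    apply: (@small_sub _ _ (fun x => all (fun t => ~~ run lam q (x + q * t)) (S v))).
      by move=> x /andP[].
    apply: (small_no_run nl (uS v)); apply: pred_pow_small => //; rewrite size_map.
    by rewrite -(leq_pmul2l (ltn0Sn 1)) mulnA (leq_trans sTe).
  apply: small_sub (small_average Y (fun y => q * lin c y)%N _ (smG c ccs)) => // x /=.
  by rewrite -ltnNge.
move=> x Gx.
have G0x : G0 (x c0) by have := Gx c0 (mem_head _ _); rewrite eqxx.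
have G1x c : c \in cs -> G1 c (x c).
  move=> ccs; have := Gx c (tailP _ ccs); case: eqP => // cc0.
  by move: c0cs; rewrite -cc0 ccs.
pose v := [seq run lam q (x p.1 + q * p.2) | p <- T].
have maskT : mask v T = [seq p <- T | run lam q (x p.1 + q * p.2)] by rewrite filter_mask.
have fine y : y \in Y -> {in cs, forall c, G c (x c + q * lin c y)%N} -> has (sol v y) E.
  move=> yY /EG[s sE h]; apply/hasP; exists s => //; apply/allP => c ccs.
  by rewrite maskT mem_filter TP// lin_padd mulnDr addnA h.
have nfine : (2 * count (fun y => ~~ has (sol v y) E) Y <= size Y)%N.
  rewrite -(@leq_pmul2l l)// mulnCA mulnA.
  apply: (@leq_trans (\sum_(c <- cs) 2 * l * count (fun y => ~~ G c (x c + q * lin c y)) Y)%N).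
    rewrite -big_distrr leq_mul//; apply: leq_trans (count_has_le _ _ _).
    apply: sub_in_count => y yY /negP nsol; apply: contrapT => /negP/hasPn h.
    by apply: nsol; apply: fine => // c /h; rewrite negbK.
  apply: (@leq_trans (\sum_(c <- cs) size Y)%N).
    by rewrite !big_seq; apply: leq_sum => c /G1x.
  by rewrite big_const_seq count_predT iter_addn_0 mulnC leq_mul2r leqnSn orbT.
have sYv : (size Y <= 2 * size (Yv v))%N.
  rewrite size_filter; have := count_predC (fun y => has (sol v y) E) Y.
  by move: nfine; rewrite [count (predC _) Y](_ : _ = count (fun y => ~~ has (sol v y) E) Y)//; lia.
(* The actual record [v] is among those excluded by [G0], and it solves the earlier forms on half of
   [Y]; so [c0] meets a run at one of these solutions. *)
have /hasPn/(_ v) := G0x; rewrite /B sYv /= => /(_ _)/allPn[|_ /mapP[y yYv ->]].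
  by rewrite -(size_map (fun p => run lam q (x p.1 + q * p.2)) T) mem_words.
rewrite negbK => r0; have sE := stE _ _ yYv.
move: yYv; rewrite mem_filter => /andP[ys yY].
exists (padd y (st v y)); first by apply/allpairsP; exists (y, st v y).
move=> c; rewrite in_cons => /orP[/eqP -> //|ccs].
have /allP/(_ c ccs) := nth_find (0, 0)%N ys.
by rewrite maskT mem_filter => /andP[].
Qed.

(** * The partition condition and sufficiency *)

Lemma mx22E p q r s i j :
  mx22 p q r s i j = if val i == 0%N then if val j == 0%N then p else q
                     else if val j == 0%N then r else s.
Proof.
by rewrite !mxE; case: splitP => i' /= ->; rewrite !mxE; case: splitP => j' /= ->;
  rewrite !mxE !ord1.
Qed.

Lemma det_mx22 p q r s : \det (mx22 p q r s) = p * s - q * r.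
Proof.
have minorE (A : 'M[int]_(1 + 1)) i j : row' i (col' j A) 0 0 = A (lift i 0) (lift j 0).
  by rewrite [LHS]mxE [LHS]mxE.
rewrite (expand_det_row _ ord0) !big_ord_recl big_ord0 /cofactor !det_mx11 !minorE !mx22E /=.
by rewrite /bump /= !expr0 expr1 mul1r mulN1r addr0 mulrN.
Qed.

(** The partition can only be the one into fibres of [i |-> (a i, b i)], so the condition reduces to
    pairs: equal or non-proportional. *)
Lemma partition_conditionP k (a b : 'cV[int]_k) :
  (forall i, 0 < a i 0) -> (forall i, 0 < b i 0) ->
  partition_condition a b <-> forall i j,
  (a i 0 = a j 0 /\ b i 0 = b j 0) \/ a i 0 * b j 0 <> b i 0 * a j 0.
Proof.
move=> a0 b0; split=> [[P partP PP] i j|ab].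
  have iP : i \in finset.cover P by rewrite (finset.cover_partition partP) finset.inE.
  have [c1 [c2 [_ _ cF ncF]]] := PP _ (finset.pblock_mem iP).
  have [ai bi] := cF i (etrans (finset.mem_pblock _ _) iP).
  have [/cF[-> ->]|/ncF] := boolP (j \in finset.pblock P i); first by left; rewrite ai bi.
  rewrite det_mx22 ai bi => h; right; apply: contra_not h.
  by rewrite mulrC (mulrC c2) => ->; rewrite subrr.
pose g i := (a i 0, b i 0).
exists (finset.preim_partition g [set: 'I_k]%SET); first exact: finset.preim_partitionP.
move=> _ /imsetP[i _ ->]; exists (a i 0), (b i 0); split=> // j.
  by rewrite !inE => /eqP[-> ->].
rewrite !inE => ij; rewrite det_mx22 => /eqP; rewrite subr_eq0 => /eqP h.
have [[h1 h2]|] := ab i j; first by rewrite /g h1 h2 eqxx in ij.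
by case; rewrite mulrC -h mulrC.
Qed.

Lemma sub_count_uniq (T : eqType) (P : pred T) (s t : seq T) :
  uniq s -> {subset s <= t} -> (count P s <= count P t)%N.
Proof.
move=> us st; rewrite -!size_filter; apply: uniq_leq_size; first exact: filter_uniq.
by move=> x; rewrite !mem_filter => /andP[-> /st].
Qed.

Lemma small_affine p k e (B : pred nat) : (0 < p)%N -> small (2 * p * e) B ->
  small e (fun n => B (p * n + k)%N).
Proof.
move=> p0 [N0 h]; exists (maxn N0 k) => N; rewrite geq_max => /andP[N0N kN].
have {h} := h (p * N + k)%N ltac:(nia).
rewrite -(count_map (fun n => p * n + k)%N B).
have : (count B [seq p * n + k | n <- iota 0 N] <= count B (iota 0 (p * N + k)))%N.
  apply: sub_count_uniq.
    by rewrite map_inj_uniq ?iota_uniq// => i j /addIn/eqP; rewrite eqn_pmul2l// => /eqP.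
  by move=> _ /mapP[n + ->]; rewrite !mem_iota; nia.
move: (count _ _) (count _ _) => u v vu h.
have h2 : (2 * (p * (v * e)) <= p * N + k)%N.
  by apply: leq_trans h; rewrite (_ : 2 * (p * (v * e)) = v * (2 * p * e))%N; [exact: leq_mul|nia].
have h3 : (k <= p * N)%N by nia.
by rewrite -(leq_pmul2l p0); lia.
Qed.

Lemma small_leq e e' B : (e <= e')%N -> small e' B -> small e B.
Proof.
by move=> ee [N0 h]; exists N0 => N /h; apply: leq_trans; rewrite leq_mul2l ee orbT.
Qed.

Lemma meets_two_param_set (R : realType) k (a b f : 'cV[int]_k) (A : set nat) :
  normal_set R A -> (forall i, 0 < a i 0) -> (forall i, 0 < b i 0) ->
  partition_condition a b -> two_param_set a b f `&` cartesian_power k A !=set0.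
Proof.
move=> [_ nA] a0 b0 /(partition_conditionP a0 b0) ab.
pose form i := (`|a i 0%R|%N, `|b i 0%R|%N).
have fa i : a i 0 = Posz (form i).1 by rewrite /= gtz0_abs.
have fb i : b i 0 = Posz (form i).2 by rewrite /= gtz0_abs.
pose cs := undup [seq form i | i : 'I_k].
have csP i : form i \in cs by rewrite mem_undup; apply/mapP; exists i; rewrite // mem_enum.
have csE c : c \in cs -> exists i, c = form i.
  by rewrite mem_undup => /mapP[i _ ->]; exists i.
have c10 : {in cs, forall c, (0 < c.1)%N} by move=> c /csE[i ->]; rewrite absz_gt0 gt_eqF.
have c20 : {in cs, forall c, (0 < c.2)%N} by move=> c /csE[i ->]; rewrite absz_gt0 gt_eqF.
have ncs : {in cs &, forall c c', c <> c' -> (c.1 * c'.2 != c.2 * c'.1)%N}.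
  move=> c c' /csE[i ->] /csE[j ->] ij; apply/negP => /eqP eij.
  case: (ab i j) => [[h1 h2]|]; first by apply: ij; rewrite /form h1 h2.
  by apply; rewrite !fa !fb -!PoszM eij.
pose F := (\sum_i `|f i 0%R|)%N.
have fF i : (`|f i 0%R| <= F)%N by rewrite /F (bigD1 i)//= leq_addr.
(* A run of this length accommodates every offset [F + f i], which lies between 0 and [2 * F];
   coordinates with the same form can thus share a run. *)
pose q := (2 * F).+1.
pose p := (\max_(c <- cs) c.1)%N.
have cp c : c \in cs -> (c.1 <= p)%N by move=> h; exact: (@leq_bigmax_seq _ cs xpredT (fun c => c.1)).
pose l := (size cs).+1.
(* The factor [2 * p] is lost in passing to the progressions [x n c], the factor [l] in the union
   over forms; the last 2 leaves bad [n] of upper density at most one half. *)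
have [E [G [smG EG]]] := common_run nA (ltn0Sn _ : 0 < q)%N (undup_uniq _) c10 ncs (2 * p * (l * 2))%N.
(* This is the value of [c] at [(n + F.+1, 1)] minus [F.+1]: [F] centres the offsets, and 1 accounts
   for the indexing from 0. The subtraction does not truncate as [c.1 > 0]. *)
pose x n (c : nat * nat) := (c.1 * n + (c.1 * F.+1 + c.2 - F.+1))%N.
have [n Gn] : exists n, {in cs, forall c, G c (x n c)}.
  have [|N0 h] := @small_has _ cs (fun c n => ~~ G c (x n c)) 2 l (ltn0Sn _) (leqnSn _).
    move=> c ccs; apply: (@small_affine _ _ _ (predC (G c)) (c10 c ccs)).
    by apply: small_leq (smG c ccs); rewrite leq_mul2r leq_mul2l cp// orbT.
  apply: contrapT => hn; have := h N0.+1 (leqnSn _).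
  rewrite (@eq_count _ _ predT) ?count_predT ?size_iota; first by lia.
  move=> n; apply/hasP; apply: contrapT => hn'; apply: hn; exists n => c ccs.
  by apply: contrapT => /negP ?; apply: hn'; exists c.
have [s sE sP] := EG _ Gn.
pose n1 := (n + F.+1 + q * s.1)%N; pose m1 := (1 + q * s.2)%N.
exists (map_mx intr (a *+ n1 + b *+ m1 + f)); split.
  by exists n1, m1; split=> //; rewrite /n1; lia.
move=> i; have /allP r := sP _ (csP i).
pose j := absz (Posz F + f i 0).
have jE : Posz j = Posz F + f i 0 by rewrite gez0_abs//; have := fF i; lia.
have jq : (j < q)%N by have := fF i; rewrite /q; lia.
set z := (x n (form i) + q * lin (form i) s)%N in r.
have : (z + j.+1)%N \in A.
  have : nth false (window (fun n => n.+1 \in A) z q) j by apply: r; rewrite mem_nth ?size_mkseq.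
  by rewrite nth_mkseq// addnS.
rewrite inE => zA; exists (z + j.+1)%N => //.
have zE : ((form i).1 * n1 + (form i).2 * m1 + j = z + j.+1 + F)%N.
  rewrite /z /x /lin /n1 /m1; have := c10 _ (csP i); have := c20 _ (csP i); rewrite /=.
  move: `|a i 0%R|%N `|b i 0%R|%N s.1 s.2 (q) => u v s1 s2 q'; clear => v0 u0.
  have [w wE] : exists w, (u * F.+1 + v = w + F.+1)%N.
    by exists (u * F.+1 + v - F.+1)%N; nia.
  by rewrite wE addnK; nia.
have {zE} : Posz (form i).1 * Posz n1 + Posz (form i).2 * Posz m1 + f i 0 = Posz (z + j.+1).
  by move: (congr1 Posz zE) jE; rewrite !PoszD !PoszM; move: (f i 0) => g; clear; lia.
rewrite -fa -fb => zE; rewrite !mxE !mulmxnE -(mulr_natr (a i 0)) -(mulr_natr (b i 0)) !natz zE.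
by rewrite -mulrz_nat natz.
Qed.

(** * Random normal sequences *)

(** A Walsh function of the sequence read from position [x]. *)
Definition chi (R : realType) (s : nat -> bool) (D : seq nat) (x : nat) : R :=
  \prod_(d <- D) (-1) ^+ s (x + d)%N.

Definition chi_sum (R : realType) (s : nat -> bool) (D : seq nat) (N : nat) : R :=
  \sum_(x <- iota 0 N) chi R s D x.

Lemma natr_eqb (R : realType) (b c : bool) :
  (b == c)%:R = 2^-1 * (1 + (-1) ^+ c * (-1) ^+ b) :> R.
Proof. by case: b; case: c; rewrite /= ?expr0 ?expr1; field. Qed.

Lemma normal_of_chi_sum (R : realType) (s : nat -> bool) :
  (forall D, uniq D -> D != [::] ->
     (fun N => chi_sum R s D N / N%:R) @ \oo --> (0 : R)) ->
  normal_sequence R s.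
Proof.
move=> h.
(* Writing an occurrence of a letter [b] as [(1 + (-1)^b (-1)^s) / 2] expands
   the frequency of a word into character sums, one letter at a time. *)
suff H w off D : uniq D -> all (fun d => (d < off)%N) D ->
    (fun N => (\sum_(x <- iota 0 N) (occurs_at s w (x + off))%:R * chi R s D x) / N%:R)
      @ \oo --> ((D == [::])%:R * 2 ^- size w : R).
  move=> w; have := H w 0%N [::] isT isT; rewrite eqxx mul1r.
  apply: cvg_trans; apply: near_eq_cvg; near=> N; congr (_ / _).
  rewrite -sum1_count natr_sum [RHS]big_mkcond; apply: eq_bigr => x _.
  by rewrite /chi big_nil mulr1 addn0; case: occurs_at.
elim: w off D => [|b w IH] off D uD Doff.
  rewrite /= expr0 invr1 mulr1.
  have [->|D0] := eqVneq D [::].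
    have c1 : (fun=> 1 : R) @ \oo --> (1 : R) by exact: cvg_cst.
    apply: cvg_trans c1; apply: near_eq_cvg; near=> N.
    under eq_bigr do rewrite /chi big_nil mulr1.
    rewrite big_const_seq count_predT size_iota iter_addr addr0 mulfV//.
    by rewrite pnatr_eq0 -lt0n; near: N; exact: nbhs_infty_gt.
  apply: cvg_trans (h D uD D0); apply: near_eq_cvg; near=> N.
  by rewrite /chi_sum; congr (_ / _); apply: eq_bigr => x _; rewrite mul1r.
have offD : off \notin D by apply/negP => /(allP Doff); rewrite ltnn.
have Doff1 : all (fun d => (d < off.+1)%N) D.
  by apply: sub_all Doff => d /ltnW.
have h1 := IH off.+1 D uD Doff1.
have h2 : (fun N => (\sum_(x <- iota 0 N)
    (occurs_at s w (x + off.+1))%:R * chi R s (off :: D) x) / N%:R) @ \oo --> (0 : R).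
  have := IH off.+1 (off :: D); rewrite /= offD uD ltnSn Doff1 mul0r; exact.
have := cvgMl_tmp (a := 2^-1) (cvgD h1 (cvgMl_tmp (a := (-1) ^+ b) h2)).
rewrite mulr0 addr0 mulrCA /= exprS invfM => /(_ _ _ _).
apply: cvg_trans; apply: near_eq_cvg; near=> N.
rewrite !fctE mulrA -mulrDl mulrA; congr (_ / _).
rewrite mulr_sumr -big_split mulr_sumr; apply: eq_bigr => x _ /=.
rewrite addnS /chi big_cons -/(chi R s D x).
have -> : occurs_at s (b :: w) (x + off) = (s (x + off)%N == b) && occurs_at s w (x + off).+1.
  rewrite /occurs_at /= /mkseq /= (iotaDl 1 0 (size w)) -map_comp eqseq_cons addn0.
  by congr (_ && (_ == _)); apply: eq_map => i /=; rewrite addnA addn1.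
by rewrite -mulnb natrM natr_eqb; ring.
Unshelve. all: by end_near. Qed.

(** The tuples [f] form a finite probability space of [M] fair bits; the default [false] turns each
    into a sequence. *)
Definition ext (M : nat) (f : {ffun 'I_M -> bool}) (n : nat) : bool :=
  if insub n is Some i then f i else false.

(** Flipping the bit at [r] is an involution on the [f] which changes the sign of exactly one
    factor, hence of each product. *)
Lemma sum_signs_eq0 (R : realType) (M r : nat) (root : nat -> nat) (sg : nat -> bool) (L : seq nat) :
  (r < M)%N -> count (fun n => root n == r) L = 1%N ->
  \sum_(f : {ffun 'I_M -> bool}) \prod_(n <- L) (-1) ^+ (ext f (root n) (+) sg n) = 0 :> R.
Proof.
move=> rM cr; set F := fun f : {ffun 'I_M -> bool} => \prod_(n <- L) (-1) ^+ (ext f (root n) (+) sg n) : R.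
pose flip (f : {ffun 'I_M -> bool}) := [ffun i => f i (+) (val i == r)].
have flipK : involutive flip.
  by move=> f; apply/ffunP => i; rewrite !ffunE -addbA addbb addbF.
have extflip f n : ext (flip f) n = ext f n (+) (n == r).
  rewrite /ext; case: insubP => [i _ <-|]; first by rewrite ffunE.
  by move=> nM; rewrite addFb; apply/esym/negP => /eqP nr; rewrite nr rM in nM.
have Fflip f : F (flip f) = - F f.
  rewrite -mulN1r -[X in X * _]expr1 -cr /F; elim: (L) => [|n l IH] /=.
    by rewrite !big_nil expr0 mulr1.
  rewrite !big_cons IH exprD extflip.
  by case: (ext f _); case: (sg n); case: (root n == r); rewrite /= ?expr0 ?expr1; ring.
have : \sum_f F f = - \sum_f F f.
  rewrite {1}(reindex_inj (inv_inj flipK)) /= -sumrN.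
  by apply: eq_bigr => f _; rewrite Fflip.
by move/eqP; rewrite -subr_eq0 opprK -mulr2n mulrn_eq0 /= => /eqP.
Qed.

(** Expand the square over pairs [(x, y)] and fix [d0] in [D]. Unless the pair is [bad], the bit at
    [root (x + d0)] is read only once in the product, whose sum over [f] then vanishes. The bound
    counts the bad pairs. *)
Lemma second_moment (R : realType) (root : nat -> nat) (sg : nat -> bool)
    (D : seq nat) (w n0 N K M : nat) :
  (forall n, (root n <= n)%N) -> uniq D -> D != [::] -> {in D, forall d, (d < w)%N} ->
  (forall n d, (n0 <= n)%N -> (0 < d < w)%N -> root n <> root (n + d)%N) ->
  (forall n, (count (fun n' => root n' == root n) (iota 0 N) <= K)%N) ->
  (N + w <= M)%N ->
  \sum_(f : {ffun 'I_M -> bool}) (chi_sum R (fun n => ext f (root n) (+) sg n) D N) ^+ 2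
    <= (2 * n0 * N + size D * N * (K + w))%:R * 2 ^+ M.
Proof.
move=> rootle uD D0.
have [d0 d0D] : exists d0, d0 \in D by case: D D0 {uD} => // d0 D' _; exists d0; rewrite mem_head.
move=> Dw root_inj rootK NM; pose s (f : {ffun 'I_M -> bool}) n := ext f (root n) (+) sg n.
pose T := {ffun 'I_M -> bool}.
have d0w : (d0 < w)%N by exact: Dw.
pose bad x y := [|| (x < n0)%N, (y < n0)%N | has (fun d => root (y + d)%N == root (x + d0)%N) D].
have pair x y : (x < N)%N -> (y < N)%N ->
    \sum_(f : T) chi R (s f) D x * chi R (s f) D y <= (bad x y)%:R * 2 ^+ M.
  move=> xN yN; case: (boolP (bad x y)) => [_|].
    rewrite mul1r; apply: (@le_trans _ _ (\sum_(f : T) 1)).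
      apply: ler_sum => f _; rewrite /chi -big_split /=.
      apply: le_trans (ler_norm _) _; rewrite normr_prod; apply: prodr_ile1 => d _.
      by rewrite normr_ge0 normrM !normrX !normrN1 !expr1n mulr1 lexx.
    by rewrite sumr_const card_ffun card_bool card_ord natrX.
  rewrite mul0r negb_or negb_or -!leqNgt => /and3P[n0x n0y nrD].
  have nr d : d \in D -> root (y + d)%N != root (x + d0)%N.
    by move=> dD; apply: contra nrD => h; apply/hasP; exists d.
  have -> : \sum_(f : T) chi R (s f) D x * chi R (s f) D y =
     \sum_(f : T) \prod_(n <- map (addn x) D ++ map (addn y) D)
        (-1) ^+ (ext f (root n) (+) sg n).
    by apply: eq_bigr => f _; rewrite big_cat /= !big_map.
  rewrite (@sum_signs_eq0 _ _ (root (x + d0)%N))//.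
    by apply: leq_ltn_trans (rootle _) _; lia.
  rewrite count_cat !count_map [X in (_ + X)%N](@eq_in_count _ _ pred0); last first.
    by move=> d dD /=; apply/negbTE; exact: nr.
  rewrite count_pred0 addn0 -[RHS](congr1 nat_of_bool d0D) -(count_uniq_mem _ uD).
  apply: eq_in_count => d dD /=; apply/eqP/eqP => [|->//] e.
  have dw := Dw _ dD; case: (ltngtP d d0) => // lt.
    case: (root_inj (x + d)%N (d0 - d)%N); [lia|lia|].
    by rewrite e -addnA subnKC// ltnW.
  case: (root_inj (x + d0)%N (d - d0)%N); [lia|lia|].
  by rewrite -addnA subnKC// ltnW.
have sq f : chi_sum R (s f) D N ^+ 2 =
    \sum_(x <- iota 0 N) \sum_(y <- iota 0 N) chi R (s f) D x * chi R (s f) D y.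
  rewrite expr2 /chi_sum mulr_suml; apply: eq_bigr => x _; exact: mulr_sumr.
rewrite (eq_bigr _ (fun f _ => sq f)) exchange_big /=.
under eq_bigr do rewrite exchange_big.
apply: (@le_trans _ _ (\sum_(x <- iota 0 N) \sum_(y <- iota 0 N) (bad x y)%:R * 2 ^+ M)).
  rewrite big_seq [leRHS]big_seq; apply: ler_sum => x; rewrite mem_iota add0n => /= xN.
  rewrite big_seq [leRHS]big_seq; apply: ler_sum => y; rewrite mem_iota add0n => /= yN.
  exact: pair.
under eq_bigr do rewrite -mulr_suml -natr_sum.
rewrite -mulr_suml -natr_sum ler_wpM2r ?exprn_ge0// ler_nat.
have countlt : (\sum_(x <- iota 0 N) (x < n0) <= n0)%N.
  rewrite -big_mkcond sum1_count -size_filter -[leqRHS](size_iota 0).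
  apply: uniq_leq_size; first by rewrite filter_uniq// iota_uniq.
  by move=> x; rewrite mem_filter !mem_iota add0n => /andP[].
have sum_const c : (\sum_(x <- iota 0 N) c = c * N)%N.
  by rewrite big_const_seq count_predT size_iota iter_addn_0.
have count_root x d : d \in D ->
    (\sum_(y <- iota 0 N) (root (y + d)%N == root (x + d0)%N) <= K + w)%N.
  move=> dD; rewrite -big_mkcond sum1_count.
  rewrite -(count_map (addn^~ d) (fun n => root n == root (x + d0)%N)).
  apply: (@leq_trans (count (fun n => root n == root (x + d0)%N) (iota 0 (N + w)))).
    apply: sub_count_uniq; first by rewrite map_inj_uniq ?iota_uniq//; exact: addIn.
    by move=> _ /mapP[y + ->]; rewrite !mem_iota; have := Dw _ dD; lia.
  rewrite iotaD count_cat leq_add// (leq_trans (count_size _ _))// size_iota//.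
apply: (@leq_trans (\sum_(x <- iota 0 N) \sum_(y <- iota 0 N)
   ((x < n0) + (y < n0) + \sum_(d <- D) (root (y + d)%N == root (x + d0)%N)))%N).
  apply: leq_sum => x _; apply: leq_sum => y _.
  rewrite /bad; case: ltnP => //= _; case: ltnP => //= _; rewrite !add0n.
  elim: (D) => [|d l IH] /=; first by rewrite big_nil.
  by rewrite big_cons; case: eqP.
apply: (@leq_trans (\sum_(x <- iota 0 N) ((x < n0) * N + n0 + size D * (K + w)))%N).
  apply: leq_sum => x _; rewrite !big_split /= sum_const !leq_add//.
  rewrite exchange_big /= -sum1_size big_distrl /= big_seq [leqRHS]big_seq.
  by apply: leq_sum => d dD; rewrite mul1n count_root.
rewrite !big_split /= !sum_const -big_distrl /=.
by move: countlt; set t := \sum_(x <- _) _; nia.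
Qed.

(* Compactness of the Cantor space: the cluster point is the limit along an
   ultrafilter. *)
Lemma cluster_sequence (f_ : nat -> nat -> bool) :
  exists om : nat -> bool, forall m J0, exists2 J, (J0 <= J)%N &
    forall n, (n < m)%N -> om n = f_ J n.
Proof.
have [U [uU sU]] := ultraFilterLemma (@eventually_filter).
pose om n := `[< U [set J | f_ J n] >].
have Uom n : U [set J | om n = f_ J n].
  rewrite /om; case: asboolP => h.
    by apply: filterS h => J /= ->.
  have [//|h'] := in_ultra_setVsetC [set J | f_ J n] uU.
  by apply: filterS h' => J /= /negP/negbTE ->.
exists om => m J0.
have Um : U [set J | forall n, (n < m)%N -> om n = f_ J n].
  elim: m => [|m IH]; first by apply: filterS filterT => J _ n.
  apply: filterS (filterI IH (Uom m)) => J [h1 h2] n.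
  by rewrite ltnS leq_eqVlt => /orP[/eqP ->//|/h1].
have UJ : U [set J | (J0 <= J)%N] by apply: sU; exists J0.
by have [J [h1 h2]] := filter_ex (filterI Um UJ); exists J.
Qed.

(** First moment method: some [t] has [\sum_i Z i t] at most the average, hence at most [C], and
    each nonnegative term is bounded by that sum. *)
Lemma simultaneous_bound (R : realType) (T : finType) (I : eqType) (r : seq I)
    (Z : I -> T -> R) (c : I -> R) (C : R) :
  (0 < #|T|)%N -> (forall i t, 0 <= Z i t) ->
  {in r, forall i, \sum_t Z i t <= c i * #|T|%:R} -> \sum_(i <- r) c i <= C ->
  exists t, {in r, forall i, Z i t <= C}.
Proof.
move=> T0 Z0 Zc cC; apply: contrapT => h.
have h1 t : C < \sum_(i <- r) Z i t.
  have [i [ir]] : exists i, i \in r /\ C < Z i t.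
    apply: contrapT => h'; apply: h; exists t => i ir; rewrite leNgt; apply/negP => lt.
    by apply: h'; exists i.
  move/lt_le_trans; apply; rewrite (big_rem i ir)/= lerDl.
  by apply: sumr_ge0 => j _.
have : \sum_(t : T) C < \sum_t \sum_(i <- r) Z i t.
  apply: ltr_sum => //; case/card_gt0P: T0 => t _; apply/hasP.
  by exists t; rewrite ?mem_index_enum.
have -> : \sum_(t : T) C = C *+ #|T| by rewrite -sumr_const; apply: eq_bigl.
rewrite exchange_big /= ltNge => /negP; apply.
apply: (@le_trans _ _ (\sum_(i <- r) c i * #|T|%:R)).
  by rewrite !big_seq; apply: ler_sum => i; exact: Zc.
by rewrite -mulr_suml -[leRHS]mulr_natr ler_wpM2r.
Qed.

Lemma sum_inv_sqr (R : realType) n : \sum_(j < n) (j.+1%:R ^+ 2)^-1 <= 2 :> R.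
Proof.
case: n => [|n]; first by rewrite big_ord0.
suff : \sum_(j < n.+1) (j.+1%:R ^+ 2)^-1 <= 2 - n.+1%:R^-1 :> R.
  by move/le_trans; apply; rewrite gerBl invr_ge0.
elim: n => [|n IH]; first by rewrite big_ord1 expr1n invr1; lra.
rewrite big_ord_recr /=; apply: le_trans (lerD IH (lexx _)) _.
have n0 : 0 < n.+1%:R :> R by rewrite ltr0n.
rewrite -(natr1 n.+1); move: n0; set t := n.+1%:R => t0.
rewrite -subr_ge0.
have -> : 2 - (t + 1)^-1 - (2 - t^-1 + ((t + 1) ^+ 2)^-1) = (t * (t + 1) ^+ 2)^-1.
  by field; apply/andP; split; rewrite gt_eqF//; lra.
by rewrite invr_ge0; apply: mulr_ge0; [lra|apply: exprn_ge0; lra].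
Qed.

Lemma sum_inv_pow2 (R : realType) n : \sum_(i < n) (2 ^+ i)^-1 <= 2 :> R.
Proof.
suff : \sum_(i < n) (2 ^+ i)^-1 = 2 - 2 * (2 ^+ n)^-1 :> R.
  by move->; rewrite gerBl mulr_ge0// invr_ge0 exprn_ge0.
elim: n => [|n IH]; first by rewrite big_ord0 expr0 invr1; lra.
by rewrite big_ord_recr /= IH exprS invfM; lra.
Qed.

Lemma chi_sum_ext (R : realType) s s' D N w : {in D, forall d, (d < w)%N} ->
  (forall n, (n < N + w)%N -> s n = s' n) -> chi_sum R s D N = chi_sum R s' D N.
Proof.
move=> Dw ss'; rewrite /chi_sum big_seq [RHS]big_seq; apply: eq_bigr => x.
rewrite mem_iota add0n => /= xN; rewrite /chi big_seq [RHS]big_seq.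
by apply: eq_bigr => d /Dw dw; rewrite ss'//; lia.
Qed.

Lemma chi_sumB (R : realType) s D N N' : (N <= N')%N ->
  `|chi_sum R s D N' - chi_sum R s D N| <= (N' - N)%:R.
Proof.
move=> NN'; rewrite /chi_sum -{1}(subnKC NN') iotaD big_cat /= add0n addrAC subrr add0r.
apply: le_trans (ler_norm_sum _ _ _) _.
have -> : (N' - N)%:R = \sum_(x <- iota N (N' - N)) 1 :> R.
  by rewrite big_const_seq count_predT size_iota iter_addr addr0.
apply: ler_sum => x _; rewrite /chi normr_prod; apply: prodr_ile1 => d _.
by rewrite normr_ge0 normrX normrN1 expr1n lexx.
Qed.

Lemma octic_bracket N : (0 < N)%N -> exists j, (j.+1 ^ 8 <= N < j.+2 ^ 8)%N.
Proof.
elim: N => // N IH _; case: N IH => [_|N /(_ isT)[j /andP[h1 h2]]]; first by exists 0%N.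
have [h|h] := ltnP N.+2 (j.+2 ^ 8)%N; first by exists j; rewrite (leq_trans h1)/=.
exists j.+1; rewrite h /=; apply: (leq_ltn_trans h2).
by rewrite ltn_exp2r.
Qed.

Lemma expn_succ_le t n : (0 < t)%N ->
  (t.+1 ^ n.+1 <= t ^ n.+1 + (2 ^ n.+1).-1 * t ^ n)%N.
Proof.
move=> t0; elim: n => [|n IH]; first by rewrite !expn1 expn0 /=; lia.
rewrite expnS (leq_trans (leq_mul (leqnn _) IH))// [in leqRHS](expnS t n.+1) [in leqRHS](expnS 2).
have : (0 < 2 ^ n.+1)%N by rewrite expn_gt0.
by rewrite (expnS t n); move: (2 ^ n.+1)%N (t ^ n)%N => a u a0; case: a a0 => // a _ /=; nia.
Qed.

(* A bound along the eighth powers suffices, as their gaps are o(N). *)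
Lemma chi_sum_cvg0 (R : realType) s D (c : nat) :
  (forall j, chi_sum R s D (j.+1 ^ 8)%N ^+ 2 <= c%:R * j.+1%:R ^+ 14) ->
  (fun N => chi_sum R s D N / N%:R) @ \oo --> (0 : R).
Proof.
move=> h; have h7 j : `|chi_sum R s D (j.+1 ^ 8)%N| <= c%:R * j.+1%:R ^+ 7.
  rewrite -(@ler_pXn2r _ 2)// ?nnegrE ?mulr_ge0 ?exprn_ge0// real_normK ?num_real//.
  apply: le_trans (h j) _; rewrite exprMn -exprM ler_wpM2r ?exprn_ge0//.
  by rewrite -natrX ler_nat; case: (c) => // c'; rewrite expnS leq_pmulr.
(* By [expn_succ_le], consecutive eighth powers differ by at most [255 * j.+1 ^ 7], where 255 is
   [2 ^ 8 - 1]. *)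
have hN N j : (j.+1 ^ 8 <= N < j.+2 ^ 8)%N -> `|chi_sum R s D N / N%:R| <= (c + 255)%:R / j.+1%:R.
  move=> /andP[h1 h2].
  have N0 : (0 < N)%N by apply: leq_trans h1; rewrite expn_gt0.
  rewrite normrM normfV (ger0_norm (ler0n _ _)) ler_pdivrMr ?ltr0n//.
  rewrite mulrAC ler_pdivlMr ?ltr0n//.
  have : `|chi_sum R s D N| <= (c + 255)%:R * j.+1%:R ^+ 7.
    rewrite -[chi_sum _ _ _ N](subrK (chi_sum R s D (j.+1 ^ 8)%N)).
    apply: le_trans (ler_normD _ _) _; rewrite addrC natrD mulrDl lerD//.
    apply: le_trans (chi_sumB _ _ _ h1) _.
    rewrite -natrX -natrM ler_nat; have := @expn_succ_le j.+1 7 isT; rewrite (_ : (2 ^ 8).-1 = 255)%N//; lia.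
  move=> le7; apply: (@le_trans _ _ ((c + 255)%:R * j.+1%:R ^+ 7 * j.+1%:R)).
    by rewrite ler_wpM2r.
  by rewrite -mulrA -exprSr ler_wpM2l// -natrX ler_nat.
apply/cvgrPdist_lt => e e0.
have [J hJ] : exists J, (c + 255)%:R / J.+1%:R < e.
  exists (Num.truncn ((c + 255)%:R / e)); rewrite ltr_pdivrMr ?ltr0n// mulrC.
  by rewrite -ltr_pdivrMr// truncnS_gt.
near=> N; rewrite sub0r normrN.
have [|j hj] := octic_bracket (_ : 0 < N)%N; first by near: N; exact: nbhs_infty_gt.
apply: le_lt_trans (hN _ _ hj) _; apply: le_lt_trans hJ.
rewrite ler_wpM2l// lef_pV2 ?posrE ?ltr0n// ler_nat.
have : (J.+1 ^ 8 < N)%N by near: N; exact: nbhs_infty_gt.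
case/andP: hj => _ h2 h1; rewrite -ltnS -(@ltn_exp2r _ _ 8)//; exact: ltn_trans h2.
Unshelve. all: by end_near. Qed.

(** Term [n] reads the random bit [root n]. Nearby terms eventually read distinct bits, and a bit is
    read [O(sqrt N)] times before [N], so at [N = j ^ 8] the second moments are [O(j ^ 12)].
    Requiring only [O(j ^ 14)] leaves the summable weights [j ^ -2], which permits all these bounds
    at once. *)
Lemma exists_normal (R : realType) (root : nat -> nat) (sg : nat -> bool) :
  (forall n, (root n <= n)%N) ->
  (forall w, exists n0, forall n d, (n0 <= n)%N -> (0 < d < w)%N -> root n <> root (n + d)%N) ->
  (exists C, forall j n, (0 < j)%N ->
     (count (fun n' => root n' == root n) (iota 0 (j ^ 2)) <= C * j)%N) ->
  exists om : nat -> bool, normal_sequence R (fun n => om (root n) (+) sg n).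
Proof.
move=> rootle root_inj [C rootC].
pose s om n := om (root n) (+) sg n.
have bound D : exists cw : nat * nat, uniq D -> D != [::] ->
    [/\ (0 < cw.1)%N, {in D, forall d, (d < cw.2)%N} & forall j M, (j.+1 ^ 8 + cw.2 <= M)%N ->
    \sum_(f : {ffun 'I_M -> bool}) chi_sum R (s (ext f)) D (j.+1 ^ 8)%N ^+ 2
      <= cw.1%:R * j.+1%:R ^+ 12 * 2 ^+ M].
  pose w := (\max_(d <- D) d).+1; have [n0 hn0] := root_inj w.
  exists ((2 * n0 + size D * (C + w)).+1, w) => uD D0 /=.
  have Dw : {in D, forall d, (d < w)%N}.
    by move=> d dD; rewrite ltnS (@leq_bigmax_seq _ D xpredT id).
  split=> // j M jM; have := @second_moment R root sg D w n0 (j.+1 ^ 8)%N (C * j.+1 ^ 4)%N M.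
  move=> /(_ rootle uD D0 Dw hn0 _ jM) hS; apply: le_trans (hS _) _.
    by move=> n; rewrite (expnM _ 4 2); apply: rootC; rewrite expn_gt0.
  rewrite ler_wpM2r ?exprn_ge0// -natrX -natrM ler_nat.
  have : (0 < j.+1 ^ 4)%N by rewrite expn_gt0.
  rewrite (expnD _ 8 4) (expnD _ 4 4); move: (j.+1 ^ 4)%N (size D) => t m t0.
  apply: (@leq_trans ((2 * n0 + m * (C + w)) * (t * t * t))%N); last by rewrite leq_mul2r leqnSn orbT.
  rewrite mulnDl leq_add//; first by rewrite leq_mul2l leq_pmulr ?orbT.
  have : (w <= w * t)%N by rewrite leq_pmulr.
  rewrite -!mulnA leq_mul2l => wt; apply/orP; right.
  by rewrite mulnC mulnA [leqRHS]mulnA leq_mul2r; apply/orP; right; nia.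
have {bound} [cw cwP] := choice bound.
(* An enumeration of the nonempty duplicate-free lists; the default [[:: 0]] makes every code a
   valid test. *)
pose Dd e := if unpickle e is Some D then
  if uniq D && (D != [::]) then D else [:: 0%N] else [:: 0%N].
have DdP e : uniq (Dd e) /\ Dd e != [::].
  by rewrite /Dd; case: unpickle => // D; case: ifP => // /andP[].
pose K e : R := (4 * (cw (Dd e)).1 * 2 ^ e)%:R.
have fin J : exists om : nat -> bool, forall e j, (e < J)%N -> (j < J)%N ->
    chi_sum R (s om) (Dd e) (j.+1 ^ 8)%N ^+ 2 <= K e * j.+1%:R ^+ 14.
  pose M := (J ^ 8 + \max_(e < J) (cw (Dd e)).2)%N.
  (* Normalised so that the mean is at most [c i]; these weights have sum at most [2 * 2 = 4]. *)
  pose Z (i : nat * nat) (f : {ffun 'I_M -> bool}) : R :=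
    chi_sum R (s (ext f)) (Dd i.1) (i.2.+1 ^ 8)%N ^+ 2 /
      (((cw (Dd i.1)).1 * 2 ^ i.1)%:R * i.2.+1%:R ^+ 14).
  pose c (i : nat * nat) : R := (2 ^+ i.1)^-1 * (i.2.+1%:R ^+ 2)^-1.
  pose r := [seq (e, j) | e <- iota 0 J, j <- iota 0 J].
  have den0 e j : 0 < ((cw (Dd e)).1 * 2 ^ e)%:R * j.+1%:R ^+ 14 :> R.
    have [uD D0] := DdP e; have [c0 _ _] := cwP _ uD D0.
    by rewrite mulr_gt0 ?exprn_gt0 ?ltr0n// muln_gt0 c0 expn_gt0.
  have [||||f fP] := @simultaneous_bound R _ _ r Z c 4.
  - by rewrite card_ffun card_bool card_ord expn_gt0.
  - by move=> [e j] f; rewrite /Z divr_ge0 ?sqr_ge0 ?ltW.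
  - move=> _ /allpairsP[[e j] [/= + + ->]]; rewrite !mem_iota !add0n /= => eJ jJ.
    rewrite /Z -mulr_suml /= ler_pdivrMr//.
    have [uD D0] := DdP e; have [c0 _ hS] := cwP _ uD D0.
    apply: le_trans (hS _ _ _) _.
      rewrite /M leq_add ?leq_exp2r//.
      exact: (@leq_bigmax _ (fun e : 'I_J => (cw (Dd e)).2) (Ordinal eJ)).
    rewrite /c /= card_ffun card_bool card_ord natrX natrM natrX.
    rewrite le_eqVlt; apply/orP; left; apply/eqP.
    have j0 : j.+1%:R != 0 :> R by rewrite pnatr_eq0.
    have e0 : 2 ^+ e != 0 :> R by rewrite expf_neq0// pnatr_eq0.
    move: j0 e0; move: (j.+1%:R) (2 ^+ e) ((cw (Dd e)).1%:R) (2 ^+ M) => t a b m t0 a0.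
    by field; rewrite t0 a0.
  - rewrite big_allpairs /c /=.
    under eq_bigr do rewrite -mulr_sumr.
    rewrite -mulr_suml -{1}[J]subn0 -{2}[J]subn0 -!/(index_iota _ _) !big_mkord.
    apply: (@le_trans _ _ (2 * 2)); last by lra.
    rewrite ler_pM ?sum_inv_pow2 ?sum_inv_sqr// sumr_ge0// => i _;
      by rewrite invr_ge0 exprn_ge0.
  exists (ext f) => e j eJ jJ; have := fP (e, j).
  rewrite /Z ler_pdivrMr// /K => /(_ _) h; rewrite -mulnA natrM -mulrA; apply: h.
  by apply/allpairsP; exists (e, j); rewrite !mem_iota.
have [f_ f_P] := choice fin; have [om omP] := cluster_sequence f_.
exists om; apply: normal_of_chi_sum => D uD D0.
have [e eD] : exists e, Dd e = D by exists (pickle D); rewrite /Dd pickleK uD D0.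
apply: (@chi_sum_cvg0 _ _ _ (4 * (cw (Dd e)).1 * 2 ^ e)%N) => j.
have [_ Dw _] := cwP _ uD D0.
(* The sum reads finitely many bits, on which [om] agrees with some [f_ J] where [J] exceeds [e] and
   [j]. *)
have [J J0 hJ] := omP (j.+1 ^ 8 + (cw D).2)%N (maxn e j).+1.
rewrite (@chi_sum_ext _ _ (s (f_ J)) _ _ (cw D).2)//; last first.
  by move=> n hn; rewrite /s hJ// (leq_ltn_trans (rootle n)).
by rewrite -eD; apply: f_P; apply: leq_ltn_trans J0; rewrite ?leq_maxl ?leq_maxr.
Qed.

(** * Alternating chains *)

(** Parents decrease, so [m] steps from [m] reach the root: recursion on a fuel [k], whose value is
    immaterial once [m <= k]. *)
Lemma chain_exists (par : nat -> option nat) :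
  (forall m n, par m = Some n -> (n < m)%N) ->
  exists root depth : nat -> nat, forall m,
    if par m is Some n then root m = root n /\ depth m = (depth n).+1
    else root m = m /\ depth m = 0%N.
Proof.
move=> par_lt.
pose fix rd (k m : nat) {struct k} : nat * nat := if k is k'.+1 then
  if par m is Some n then ((rd k' n).1, (rd k' n).2.+1) else (m, 0%N) else (m, 0%N).
have rdE k k' m : (m <= k)%N -> (m <= k')%N -> rd k m = rd k' m.
  elim: k k' m => [|k IH] [|k'] m //=; rewrite ?leqn0.
  - by move=> /eqP -> _; case E: (par 0%N) => [n|//]; have := par_lt _ _ E.
  - by move=> _ /eqP ->; case E: (par 0%N) => [n|//]; have := par_lt _ _ E.
  move=> mk mk'; case E: (par m) => [n|//]; have nm := par_lt _ _ E.
  by rewrite (IH k')//; lia.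
exists (fun m => (rd m m).1), (fun m => (rd m m).2) => m.
case: m => [|m]; first by case E: (par 0%N) => [n|//]; have := par_lt _ _ E.
case E: (par m.+1) => [n|]; rewrite /= E//=.
by have nm := par_lt _ _ E; rewrite (rdE m n)//; lia.
Qed.

(** Each term is the random bit of its root, negated at odd depth. As [par] is injective, root and
    depth determine a point of a chain; as [m] exceeds its parent by a factor [1 + 1 / P], chains
    are sparse enough for [exists_normal]. *)
Lemma normal_alternating_chains (R : realType) (par : nat -> option nat) (P : nat) :
  (0 < P)%N ->
  (forall m n, par m = Some n -> (n < m)%N /\ (n * P.+1 <= P * m)%N) ->
  (forall m m' n, par m = Some n -> par m' = Some n -> m = m') ->
  exists s, normal_sequence R s /\ forall m n, par m = Some n -> s m = ~~ s n.
Proof.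
move=> P0 par_gap par_inj.
have par_lt m n : par m = Some n -> (n < m)%N by case/par_gap.
have [root [depth rdP]] := chain_exists par_lt.
have rdS m n : par m = Some n -> root m = root n /\ depth m = (depth n).+1.
  by move=> mn; have := rdP m; rewrite mn.
have depth0 m : depth m = 0%N -> root m = m.
  by have := rdP m; case: (par m) => [n [_ ->]|[]].
have depthS m d : depth m = d.+1 -> exists2 n, par m = Some n & root m = root n /\ depth n = d.
  have := rdP m; case E: (par m) => [n|]; last by case=> _ ->.
  by move=> [-> ->] [<-]; exists n.
have root_le m : (root m <= m)%N.
  elim/ltn_ind: m => m IH; have := rdP m; case E: (par m) => [n|]; last by case=> ->.
  by have nm := par_lt _ _ E; case=> -> _; rewrite (leq_trans (IH n nm))// ltnW.
have rd_inj m m' : root m = root m' -> depth m = depth m' -> m = m'.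
  move: {2}(depth m) (erefl (depth m)) => d; elim: d m m' => [|d IH] m m' md rr dd.
    by rewrite -(depth0 m)// -(depth0 m') -?dd.
  have [n mn [rn dn]] := depthS _ _ md; have [n' mn' [rn' dn']] := depthS m' d (etrans (esym dd) md).
  have nn : n = n' by apply: IH => //; [rewrite -rn rr|rewrite dn].
  by apply: par_inj mn _; rewrite nn.
have depth_le m : (depth m <= m)%N.
  elim/ltn_ind: m => m IH; have := rdP m; case E: (par m) => [n|]; last by case=> _ ->.
  by have nm := par_lt _ _ E; case=> _ ->; apply: leq_ltn_trans (IH n nm) nm.
(* The depth is in fact logarithmic in [m]; this quadratic bound gives the square root needed and
   follows from [depth n <= n]. *)
have depth_sq m : (depth m * (depth m).-1 <= 2 * P * m)%N.
  elim/ltn_ind: m => m IH; have := rdP m; case E: (par m) => [n|]; last by case=> _ ->.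
  have [nm nP] := par_gap _ _ E; case=> _ ->; have := IH n nm; have := depth_le n.
  by case: (depth n) => [|d] /=; nia.
have root_mono n m : root n = root m -> (depth n <= depth m)%N -> (n <= m)%N.
  elim/ltn_ind: m => m IH rr; rewrite leq_eqVlt => /orP[/eqP/rd_inj -> //|].
  have := rdP m; case E: (par m) => [n'|]; last by case=> _ ->.
  have nm := par_lt _ _ E; case=> rn -> dn.
  by apply: leq_trans (ltnW nm); apply: IH => //; rewrite rr.
have root_gap n d : (0 < d)%N -> root n = root (n + d)%N -> (n <= P * d)%N.
  move=> d0 rr; have dd : (depth n < depth (n + d)%N)%N.
    by rewrite ltnNge; apply/negP => /(root_mono _ _ (esym rr)); lia.
  have := rdP (n + d)%N; case E: (par (n + d)%N) => [n'|]; last by case=> _ e; rewrite e in dd.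
  have [nm nP] := par_gap _ _ E; case=> rn de; have : (n <= n')%N.
    by apply: root_mono; [rewrite rr|rewrite de in dd].
  by nia.
have [||om nom] := @exists_normal R root (fun n => odd (depth n)) root_le.
- move=> w; exists (P * w).+1 => n d nw /andP[d0 dw] /(root_gap _ _ d0).
  by nia.
(* Depth is injective on a chain, and by [depth_sq] it stays below [2 * P * j + 2] before
   [j ^ 2]. *)
- exists (2 * P + 2)%N => j n j0.
  rewrite -size_filter -(size_map depth).
  apply: (@leq_trans (size (iota 0 (2 * P * j + 2)))); last by rewrite size_iota; nia.
  apply: uniq_leq_size.
    rewrite map_inj_in_uniq ?filter_uniq ?iota_uniq// => m m'.
    rewrite !mem_filter => /andP[/eqP rm _] /andP[/eqP rm' _]; apply: rd_inj.
    by rewrite rm rm'.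
  move=> _ /mapP[m + ->]; rewrite mem_filter !mem_iota !add0n => /andP[_ /= mj].
  rewrite ltnNge; apply/negP => h; have := depth_sq m; move: (depth m) h => d h.
  have : ((2 * P * j + 2) * (2 * P * j + 1) <= d * d.-1)%N by apply: leq_mul; lia.
  by move: mj; rewrite expnS expn1; nia.
exists (fun n => om (root n) (+) odd (depth n)); split=> // m n /rdS[-> ->] /=.
by rewrite addbN.
Qed.

(** * Normal sets, and a linear equation without solutions *)

Lemma normal_eventually_eq (R : realType) (s s' : nat -> bool) n1 :
  (forall n, (n1 <= n)%N -> s n = s' n) -> normal_sequence R s -> normal_sequence R s'.
Proof.
move=> ss' ns w.
pose c t := (count (occurs_at t w) (iota 0 n1))%:R : R.
have inv0 : (fun N => (c s' - c s) * N%:R^-1) @ \oo --> (0 : R).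
  rewrite -[X in _ --> X](mulr0 (c s' - c s)); apply: cvgMl_tmp.
  apply/cvgrPdist_lt => e e0; near=> N.
  rewrite sub0r normrN normfV ger0_norm// invf_plt ?posrE ?ltr0n//; last first.
    by near: N; exact: nbhs_infty_gt.
  by near: N; exact: nbhs_infty_gtr.
rewrite -[X in _ --> X]addr0; apply: cvg_trans (cvgD (ns w) inv0).
apply: near_eq_cvg; near=> N.
rewrite fctE -mulrDl; congr (_ / _).
have n1N : (n1 <= N)%N by near: N; exact: nbhs_infty_ge.
rewrite -(subnKC n1N) iotaD !count_cat !natrD add0n -!/(c _).
rewrite (@eq_in_count _ (occurs_at s w) (occurs_at s' w)); first by ring.
move=> n; rewrite mem_iota => /andP[nn _]; rewrite /occurs_at; congr (_ == _).
by apply: eq_map => i; apply: ss'; lia.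
Unshelve. all: by end_near. Qed.

Lemma exists_normal_sequence (R : realType) : exists s, normal_sequence R s.
Proof.
by have [s [ns _]] := @normal_alternating_chains R (fun=> None) 1 isT
  (fun m n (h : None = Some n) => ltac:(discriminate h))
  (fun m m' n (h : None = Some n) => ltac:(discriminate h)); exists s.
Qed.

(** The predecessor matches the index shift in [normal_set]. *)
Definition tail_set (K : nat) (s : nat -> bool) : set nat :=
  [set x | (K < x)%N && s x.-1].

Lemma normal_tail_set (R : realType) K s :
  normal_sequence R s -> normal_set R (tail_set K s).
Proof.
move=> ns; split=> [x /andP[/= + _]|]; first exact: leq_ltn_trans.
apply: (@normal_eventually_eq R s _ K _ ns) => n Kn.
by apply/idP/idP; rewrite inE /tail_set /= ltnS Kn.
Qed.

(** When [p < q], a solution has [x] larger than [y] by a definite factor once [y] is large. Taking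
    [y] as parent of [x] gives alternating chains, on which [x] and [y] cannot both carry a 1. *)
Lemma normal_set_avoiding (R : realType) (p q : nat) (r : int) :
  (0 < p)%N -> (0 < q)%N -> p != q -> exists2 A, normal_set R A &
    forall x y, A x -> A y -> Posz p * Posz x <> Posz q * Posz y + r.
Proof.
wlog pq : p q r / (p < q)%N => [th|].
  move=> p0 q0; rewrite neq_ltn => /orP[pq|qp]; first by apply: th => //; rewrite ltn_eqF.
  have [|A nA Apq] := th q p (- r) qp q0 p0; first by rewrite ltn_eqF.
  by exists A => // x y Ax Ay e; apply: (Apq y x Ay Ax); rewrite e; ring.
(* [r'] is the constant of the equation in the indices [x - 1] and [y - 1]. Beyond [K] one has
   [|r'| < n / 2], so [p * m >= (p + 1 / 2) * n], which is the gap condition with [P = 2 * p]. *)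
move=> p0 q0 _; pose r' := r + Posz q - Posz p; pose K := (2 * `|r'|)%N.
pose par m : option nat := omap val
  [pick n : 'I_m | (K < n)%N && (Posz p * Posz m == Posz q * Posz n + r')].
have parP m n : par m = Some n -> (K < n)%N /\ Posz p * Posz m = Posz q * Posz n + r'.
  by rewrite /par; case: pickP => //= i /andP[h /eqP e] [<-].
have par_gap m n : (K < n)%N -> Posz p * Posz m = Posz q * Posz n + r' ->
    (n < m)%N /\ (n * (2 * p).+1 <= 2 * p * m)%N.
  by rewrite /K; move: (r') => t Kn e; split; nia.
have pZ : Posz p != 0 by rewrite eqz_nat -lt0n.
have qZ : Posz q != 0 by rewrite eqz_nat -lt0n.
have [|||s [ns sP]] := @normal_alternating_chains R par (2 * p)%N.
- by rewrite muln_gt0.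
- by move=> m n /parP[]; exact: par_gap.
- by move=> m m' n /parP[_ e] /parP[_]; rewrite -e => /(mulfI pZ)[].
exists (tail_set K.+1 s); first exact: normal_tail_set.
move=> x y /andP[Kx sx] /andP[Ky sy] e.
have xy : Posz p * Posz x.-1 = Posz q * Posz y.-1 + r'.
  by case: x y Kx Ky e {sx sy} => [|x] [|y] // _ _; rewrite /r' /=; lia.
have Ky1 : (K < y.-1)%N by case: (y) Ky.
have pxy : par x.-1 = Some y.-1.
  have [yx _] := par_gap _ _ Ky1 xy.
  rewrite /par; case: pickP => [i /= /andP[_ /eqP e']|/(_ (Ordinal yx))] /=; last first.
    by rewrite Ky1 xy eqxx.
  by congr Some; move: e'; rewrite xy => /addIr/(mulfI qZ)[->].
by move: sx; rewrite (sP _ _ pxy) sy.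
Qed.

(** * The direction of the affine subspace *)

(** On a line [u + t *: w], with [u] good for the tail and [w] for the head, each [phi j] is a
    nonzero polynomial in [t]. Their product has finitely many roots, so some natural [t] avoids
    them all. *)
Lemma generic_vector (F : numFieldType) (vT : vectType F) (V : {vspace vT})
    (I : eqType) (phi : I -> vT -> F) (r : seq I) :
  (forall i u w t, phi i (u + t *: w) = phi i u + t * phi i w) ->
  {in r, forall i, exists2 u, u \in V & phi i u != 0} ->
  exists2 u, u \in V & {in r, forall i, phi i u != 0}.
Proof.
move=> phil; elim: r => [_|i r IH ex]; first by exists 0; rewrite ?mem0v.
have [|u uV ur] := IH; first by move=> j jr; apply: ex; rewrite inE jr orbT.
have [w wV wi] := ex i (mem_head _ _).
pose lf j := (phi j u)%:P + phi j w *: 'X.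
pose P := \prod_(j <- i :: r) lf j.
have P0 : P != 0.
  rewrite /P prodf_seq_neq0; apply/allP => j jr /=; apply: contraNneq wi => lf0.
  have c0 : phi j u = 0 by have := congr1 (coefp 0) lf0; rewrite /= coefD coefC coefZ coefX coef0 mulr0 addr0.
  have c1 : phi j w = 0 by have := congr1 (coefp 1) lf0; rewrite /= coefD coefC coefZ coefX coef0 mulr1 add0r.
  move: jr; rewrite inE => /orP[/eqP <-|jr]; first by rewrite c1.
  by have := ur _ jr; rewrite c0 eqxx.
have [t Pt] : exists t : nat, P.[t%:R] != 0.
  apply: contrapT => h.
  pose rs : seq F := [seq t%:R | t <- iota 0 (size P)].
  have rsP : all (root P) rs.
    apply/allP => _ /mapP[t _ ->]; apply/rootP/eqP; apply: contrapT => /negP ?.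
    by apply: h; exists t.
  have rsu : uniq rs by rewrite map_inj_uniq ?iota_uniq// => m n /eqP; rewrite eqr_nat => /eqP.
  by have := max_poly_roots P0 rsP rsu; rewrite size_map size_iota ltnn.
exists (u + t%:R *: w); first by rewrite memvD// memvZ.
move=> j jr; rewrite phil; move: Pt; rewrite /P horner_prod prodf_seq_neq0 => /allP/(_ j jr).
by rewrite /lf !hornerE mulrC.
Qed.

Lemma clear_denominators k (u : 'cV[rat]_k) :
  exists (d : int) (w : 'cV[int]_k), 0 < d /\ d%:~R *: u = map_mx intr w.
Proof.
exists (\prod_i denq (u i 0)), (\col_i (numq (u i 0) * \prod_(j | j != i) denq (u j 0))).
split; first by apply: prodr_gt0 => i _; exact: denq_gt0.
by apply/matrixP => i j; rewrite !mxE (ord1 j) (bigD1 i)//= !intrM numqE; ring.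
Qed.

Lemma affine_subspaceP k (X : set 'cV[rat]_k) : affine_subspace X ->
  exists V : {vspace 'cV[rat]_k},
    (forall x y, X x -> X y -> x - y \in V) /\ (forall x u, X x -> u \in V -> X (x + u)).
Proof.
move=> [v [V ->]]; exists V; split=> [_ _ [u /= uV <-] [w /= wV <-]|_ u [w /= wV <-] uV].
  by rewrite opprD addrACA subrr add0r memvB.
by exists (w + u); rewrite ?addrA//= memvD.
Qed.

Theorem theorem1p3p2 (R : realType) (k : nat) (hk : (0 < k)%N)
    (X : set 'cV[rat]_k) (hX : affine_subspace X) :
  (forall A : set nat, normal_set R A -> X `&` cartesian_power k A !=set0)
  <->
  (exists a b f : 'cV[int]_k,
     [/\ forall i, 0 < a i 0,
         forall i, 0 < b i 0,
         partition_condition a b &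
         two_param_set a b f `<=` X]).
Proof.
split=> [hA|[a [b [f [a0 b0 ab abX]]]] A nA]; last first.
  have [x [abx Ax]] := meets_two_param_set f nA a0 b0 ab.
  by exists x; split=> //; exact: abX.
have [V [subV addV]] := affine_subspaceP hX.
have [s ns] := exists_normal_sequence R.
have coord A : normal_set R A -> exists (x : 'cV[rat]_k) (n : 'I_k -> nat),
    [/\ X x, forall i, A (n i) & forall i, x i 0 = (n i)%:R].
  move=> /hA[x [Xx Ax]].
  have /choice[n nP] : forall i, exists m, A m /\ x i 0 = m%:R.
    by move=> i; have [m Am xm] := Ax i; exists m.
  by exists x, n; split=> // i; have [] := nP i.
have [z0 [n0 [Xz0 _ z0E]]] := coord _ (normal_tail_set 0 ns).
(* All coordinates of this second point exceed those of [z0], so the difference [a] is a positive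
   integral vector in the direction [V]. *)
have [z1 [n1 [Xz1 An1 z1E]]] := coord _ (normal_tail_set (\max_i n0 i)%N ns).
have n01 i : (n0 i < n1 i)%N.
  by have /andP[+ _] := An1 i; apply: leq_ltn_trans; exact: leq_bigmax.
pose a : 'cV[int]_k := \col_i (Posz (n1 i) - Posz (n0 i)).
pose f : 'cV[int]_k := \col_i Posz (n0 i).
have aE i : a i 0 = Posz (n1 i) - Posz (n0 i) by rewrite mxE.
have a0 i : 0 < a i 0 by rewrite aE subr_gt0 ltz_nat.
have aV : map_mx intr a \in V.
  have -> : map_mx intr a = z1 - z0; last exact: subV.
  by apply/matrixP => i j; rewrite !mxE (ord1 j) z0E z1E rmorphB.
(* The determinant of the rows [i] and [j] of the matrix with columns [u] and [a]. *)
pose phi (ij : 'I_k * 'I_k) (u : 'cV[rat]_k) : rat :=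
  u ij.1 0 * (a ij.2 0)%:~R - u ij.2 0 * (a ij.1 0)%:~R.
have mapE (c : 'cV[int]_k) i : map_mx (intr : int -> rat) c i 0 = (c i 0)%:~R by rewrite mxE.
have phil ij u w t : phi ij (u + t *: w) = phi ij u + t * phi ij w.
  by rewrite /phi !mxE; ring.
(* Under this assumption [a j * x i - a i * x j] is constant on [X], with its value at [z0]; if
   [a i] and [a j] differed, a normal set avoiding this equation would contradict [hA]. *)
have rigid i j : (forall u, u \in V -> phi (i, j) u = 0) -> a i 0 = a j 0.
  move=> phi0; apply: contrapT => aij.
  have [p pE] : exists p, a j 0 = Posz p by exists (n1 j - n0 j)%N; rewrite aE; have := n01 j; lia.
  have [q qE] : exists q, a i 0 = Posz q by exists (n1 i - n0 i)%N; rewrite aE; have := n01 i; lia.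
  have p0 : (0 < p)%N by have := a0 j; rewrite pE ltz_nat.
  have q0 : (0 < q)%N by have := a0 i; rewrite qE ltz_nat.
  have pq : p != q by apply/eqP => e; apply: aij; rewrite pE qE e.
  have [A nA Apq] := @normal_set_avoiding R p q (Posz p * Posz (n0 i) - Posz q * Posz (n0 j)) p0 q0 pq.
  have [x [n [Xx An xE]]] := coord A nA.
  apply: (Apq (n i) (n j) (An i) (An j)).
  have := phi0 _ (subV _ _ Xx Xz0); rewrite /phi /= pE qE.
  have subE l : (x - z0) l 0 = (n l)%:R - (n0 l)%:R by rewrite !mxE xE z0E.
  rewrite !subE => e.
  apply/eqP; rewrite -(@eqr_int rat) !(rmorphD, rmorphB, rmorphM, rmorphN) /=.
  rewrite -subr_eq0 -e; apply/eqP; ring.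
pose r := [seq ij <- enum {: 'I_k * 'I_k} | `[< exists2 u, u \in V & phi ij u != 0 >] ].
have [|u uV ur] := @generic_vector _ _ V _ phi r phil.
  by move=> ij; rewrite mem_filter => /andP[/asboolP].
have [d [w [d0 dw]]] := clear_denominators u.
(* [T] exceeds every [|w i|], so adding [T *: a] makes [w] positive; it leaves each [phi] unchanged,
   since [phi] vanishes at [a]. *)
pose T : int := 1 + \sum_i `|w i 0|.
pose b : 'cV[int]_k := w + T *: a.
have b0 i : 0 < b i 0.
  rewrite !mxE; have : `|w i 0| < T.
    by rewrite /T (bigD1 i)//= addrCA ltrDl ltr_pwDl// sumr_ge0.
  by have := a0 i; rewrite aE; move: (Posz (n1 i) - _) (w i 0) (T) => x y t; nia.
have bE : map_mx intr b = d%:~R *: u + T%:~R *: map_mx intr a.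
  by rewrite dw /b map_mxD map_mxZ.
have bV : map_mx intr b \in V by rewrite bE memvD// memvZ.
have phib i j : phi (i, j) (map_mx intr b) = d%:~R * phi (i, j) u.
  have phi0 : phi (i, j) 0 = 0 by rewrite /phi !mxE !mul0r subrr.
  have phia : phi (i, j) (map_mx intr a) = 0 by rewrite /phi !mapE mulrC subrr.
  by rewrite bE phil phia mulr0 addr0 -[d%:~R *: u]add0r phil phi0 add0r.
have phibE i j : phi (i, j) (map_mx intr b) = (b i 0 * a j 0 - b j 0 * a i 0)%:~R.
  by rewrite /phi !mapE rmorphB !rmorphM.
exists a, b, f; split=> //.
  apply/partition_conditionP => // i j.
  have [ijr|] := boolP ((i, j) \in r).
    right => e; have := ur _ ijr; apply/negP; rewrite negbK.
    have d1 : d%:~R != 0 :> rat by rewrite intr_eq0 gt_eqF.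
    rewrite -(mulrI_eq0 _ (lregP d1)) -phib phibE intr_eq0 subr_eq0.
    by rewrite -e mulrC.
  (* Outside [r] the form [phi (i, j)] vanishes on [V]: [rigid] gives [a i = a j], and its vanishing
     at [b] then gives [b i = b j]. *)
  rewrite mem_filter mem_enum andbT => /asboolP nex; left.
  have phi0 v : v \in V -> phi (i, j) v = 0.
    by move=> vV; apply: contrapT => /eqP ?; apply: nex; exists v.
  have aij := rigid _ _ phi0; split=> //.
  have := phi0 _ bV; rewrite phibE aij => /eqP; rewrite intr_eq0 -mulrBl mulf_eq0.
  by rewrite [a j 0 == 0]gt_eqF// orbF subr_eq0 => /eqP.
move=> _ [n [m [_ _ ->]]].
have mapL (u1 u2 u3 : 'cV[int]_k) : map_mx (intr : int -> rat) (u1 *+ n + u2 *+ m + u3) =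
    map_mx intr u3 + (n%:R *: map_mx intr u1 + m%:R *: map_mx intr u2).
  by rewrite !map_mxD addrC !raddfMn /= !scaler_nat.
have -> : map_mx intr (a *+ n + b *+ m + f) = z0 + (n%:R *: map_mx intr a + m%:R *: map_mx intr b).
  by rewrite mapL; congr (_ + _); apply/matrixP => i j; rewrite !mxE (ord1 j) z0E.
by apply: addV => //; rewrite memvD// memvZ.
Qed.
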